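(* Let $X$ be a compact Hausdorff space such that (1) $X$ is totally disconnected, (2) $X$ is not extremally disconnected, and (3) $X$ has no $G_\delta$ points. Then $C(X)$ fails the lifting property. In particular, for every uncountable cardinal $\kappa$, the $C^*$-algebra $C^*\left(\bigoplus_{\kappa}\mathbb{Z}_2\right)=C(2^\kappa)$ fails the lifting property.
   Context: A cpc map is a completely positive contractive linear map. A $C^*$-algebra $A$ has the lifting property (LP) if for every $C^*$-algebra $B$, every closed two-sided ideal $J$ of $B$, and every cpc map $\phi:A\to B/J$, there is a cpc map $\theta:A\to B$ lifting $\phi$, i.e. $\pi_J\circ\theta=\phi$, where $\pi_J:B\to B/J$ is the quotient map. $A$ fails the lifting property if it does not have it. $C(X)$ is the $C^*$-algebra of continuous complex-valued functions on $X$. A space is extremally disconnected if the closure of every open set is open. A point $x\in X$ is a $G_\delta$ point if $\{x\}$ is a countable intersection of open subsets of $X$. $\mathbb{Z}_2$ is the cyclic group of order $2$, $\bigoplus_\kappa\mathbb{Z}_2$ is the direct sum of $\kappa$ copies of it with the discrete topology, $C^*(\cdot)$ is the full group $C^*$-algebra, and $2^\kappa=\{0,1\}^\kappa$ carries the product topology; the equality $C^*(\bigoplus_\kappa\mathbb{Z}_2)=C(2^\kappa)$ is the canonical identification (by Pontryagin duality). *)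

(* Defs.v *)
From HB Require Import structures.
From mathcomp Require Import all_boot all_order all_algebra finmap.
From mathcomp Require Import complex lra.
From mathcomp Require Import all_classical all_reals.
From mathcomp Require Import interval_inference topology normedtype.
From mathcomp Require Import sequences function_spaces borel_hierarchy.
From mathcomp Require Import -(notations) monalg.
Import numFieldNormedType.Exports.
Set Implicit Arguments. Unset Strict Implicit. Unset Printing Implicit Defensive.
Import Order.TTheory GRing.Theory Num.Theory.
Local Open Scope classical_set_scope.
Local Open Scope ring_scope.
Local Open Scope complex_scope.

(* Complex *-algebras, not necessarily unital (hence not mathcomp rings).
   The scalars are R[i], with c^* the complex conjugate of c. *)
HB.mixin Record isStarAlgebra (R : realType) V & GRing.Lmodule R[i] V := {
  amul : V -> V -> V;
  star : V -> V;
  amulA : associative amul;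
  amulDl : left_distributive amul +%R;
  amulDr : right_distributive amul +%R;
  amulZl : forall (c : R[i]) x y, amul (c *: x) y = c *: amul x y;
  amulZr : forall (c : R[i]) x y, amul x (c *: y) = c *: amul x y;
  starK : involutive star;
  starD : {morph star : x y / x + y};
  starZ : forall (c : R[i]) x, star (c *: x) = c^* *: star x;
  starM : forall x y, star (amul x y) = amul (star y) (star x)
}.
#[short(type="starAlgType")]
HB.structure Definition StarAlgebra (R : realType) :=
  {V of GRing.Lmodule R[i] V & isStarAlgebra R V}.

Notation "x ** y" := (amul x y) (at level 40, left associativity) : ring_scope.

HB.mixin Record isNormedStarAlgebra (R : realType) V
    & StarAlgebra R V & NormedModule R[i] V := {
  normaM : forall x y : V, `|x ** y| <= `|x| * `|y|
}.
#[short(type="normedStarAlgType")]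
HB.structure Definition NormedStarAlgebra (R : realType) :=
  {V of StarAlgebra R V & NormedModule R[i] V & isNormedStarAlgebra R V}.

(* A C*-algebra is a complete normed *-algebra with the C*-identity. *)
HB.mixin Record isCStarAlgebra (R : realType) V & NormedStarAlgebra R V := {
  norm_starM : forall x : V, `|star x ** x| = `|x| ^+ 2
}.
#[short(type="cstarAlgType")]
HB.structure Definition CStarAlgebra (R : realType) :=
  {V of NormedStarAlgebra R V & Complete V & isCStarAlgebra R V}.

Section RealNorm.
Variables (R : realType) (V : normedModType R[i]).
Implicit Types (x y : V) (u : nat -> V).

(* The norm of a normedModType R[i] takes its (real) values in R[i]; rnorm
   is the same norm with values in R. *)
Definition rnorm x : R := complex.Re `|x|.

Lemma rnormE x : `|x| = (rnorm x)%:C.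
Proof. by rewrite /rnorm RRe_real// normr_real. Qed.

Lemma rnorm_ge0 x : 0 <= rnorm x.
Proof. by rewrite -ler0c -rnormE. Qed.

Lemma rnorm0_eq0 x : rnorm x = 0 -> x = 0.
Proof. by move=> x0; apply/eqP; rewrite -normr_eq0 rnormE x0. Qed.

Lemma rnormD x y : rnorm (x + y) <= rnorm x + rnorm y.
Proof. by rewrite -lecR rmorphD/= -!rnormE ler_normD. Qed.

Lemma rnormZ (c : R[i]) x : rnorm (c *: x) = complex.Re `|c| * rnorm x.
Proof.
by apply: complexI; rewrite rmorphM/= -!rnormE normrZ.
Qed.

Lemma rnormB x y : rnorm (x - y) = rnorm (y - x).
Proof. by apply: complexI; rewrite -!rnormE distrC. Qed.

Lemma le_rnorm x (e : R) : (`|x| <= e%:C) = (rnorm x <= e).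
Proof. by rewrite rnormE lecR. Qed.

Lemma lt_rnorm x (e : R) : (`|x| < e%:C) = (rnorm x < e).
Proof. by rewrite rnormE ltcR. Qed.

End RealNorm.

Lemma homogeneous_le (R : realType) (V : lmodType R[i]) (p : V -> R) :
  (forall x, 0 <= p x) ->
  (forall (c : R[i]) x, p (c *: x) <= complex.Re `|c| * p x) ->
  forall (c : R[i]) x, p (c *: x) = complex.Re `|c| * p x.
Proof.
move=> p0 pZ c x; apply/eqP; rewrite eq_le pZ andTb.
have cE (d : R[i]) : `|d| = (complex.Re `|d|)%:C by rewrite RRe_real// normr_real.
have [->|c_neq0] := eqVneq c 0; first by rewrite normr0 mul0r p0.
have c_gt0 : 0 < complex.Re `|c| by rewrite -ltcR -cE normr_gt0.
rewrite -ler_pdivlMl// -{1}[x]scale1r -(mulVf c_neq0) -scalerA.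
by apply: le_trans (pZ _ _) _; rewrite normfV {1}(cE c) -fmorphV/=.
Qed.

Section SeqCauchy.
Variables (R : realType) (V : zmodType) (p : V -> R).

(* Stated for an arbitrary p, to be used with norms and with seminorms. *)
Definition seq_cauchy (u : nat -> V) := forall e : R, 0 < e ->
  exists N, forall m n, (N <= m)%N -> (N <= n)%N -> p (u m - u n) < e.

Definition seq_cvg (u : nat -> V) (l : V) := forall e : R, 0 < e ->
  exists N, forall n, (N <= n)%N -> p (u n - l) < e.

End SeqCauchy.

Lemma gt0_complex (R : realType) (e : R[i]) : 0 < e ->
  0 < complex.Re e /\ e = (complex.Re e)%:C.
Proof.
move=> e0; have eE : e = (complex.Re e)%:C by rewrite RRe_real// gtr0_real.
by split=> //; rewrite -ltcR -eE.
Qed.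

Lemma seq_complete (R : realType) (V : normedModType R[i]) :
  (forall u : nat -> V, seq_cauchy (@rnorm R V) u ->
     exists l, seq_cvg (@rnorm R V) u l) ->
  forall F : set_system V, ProperFilter F -> cauchy F -> cvg F.
Proof.
move=> complV F FF Fcauchy.
have Fc (e : R[i]) : 0 < e -> exists x, F (ball x e).
  by move: e; apply: (cauchyP F).1.
have e_gt0 n : 0 < (n.+1%:R^-1 : R) by rewrite invr_gt0 ltr0n.
have /choice[u Fu] : forall n, exists x, F (ball x (n.+1%:R^-1 : R)%:C).
  by move=> n; apply: Fc; rewrite ltcR.
have ball_nrm x y (e : R) : ball x e%:C y -> rnorm (x - y) < e.
  by rewrite -ball_normE /ball_/= lt_rnorm.
have small (e : R) : 0 < e -> exists N, forall n, (N <= n)%N ->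
    (n.+1%:R^-1 : R) < e.
  move=> e0; have [N _ NP] := near_infty_natSinv_lt (PosNum e0).
  by exists N => n /NP.
have uc : seq_cauchy (@rnorm R V) u.
  move=> e e0; have [N NP] := small _ (divr_gt0 e0 (ltr0n R 2)).
  exists N => m n Nm Nn.
  have [z [/ball_nrm mz /ball_nrm nz]] := filter_ex (filterI (Fu m) (Fu n)).
  have -> : u m - u n = (u m - z) + (z - u n) by rewrite addrA subrK.
  apply: le_lt_trans (rnormD _ _) _; rewrite [rnorm (z - _)]rnormB.
  rewrite (splitr e) ltrD//; first exact: lt_trans mz (NP _ _).
  exact: lt_trans nz (NP _ _).
have [l ul] := complV _ uc.
apply/cvg_ex; exists l; apply/cvgrPdist_lt => e /gt0_complex[e0 ->].
have e20 := divr_gt0 e0 (ltr0n R 2).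
have [N1 N1P] := small _ e20; have [N2 N2P] := ul _ e20.
have := Fu (maxn N1 N2); apply: filterS => x /ball_nrm ux.
rewrite lt_rnorm.
have -> : l - x = (l - u (maxn N1 N2)) + (u (maxn N1 N2) - x) by rewrite addrA subrK.
apply: le_lt_trans (rnormD _ _) _; rewrite [rnorm (l - _)]rnormB.
rewrite (splitr (complex.Re e)) ltrD ?N2P ?leq_maxr//.
by apply: lt_trans ux (N1P _ _); rewrite leq_maxl.
Qed.

Lemma R_seq_complete (R : realType) (u : nat -> R) :
  (forall e : R, 0 < e -> exists N, forall m n, (N <= m)%N -> (N <= n)%N ->
     `|u m - u n| < e) ->
  cvgn u.
Proof.
move=> uc; apply: R_complete; apply/cauchy_exP => e e0.
have [N NP] := uc _ e0; exists (u N); exists N => // n /= Nn.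
by rewrite /ball/= NP.
Qed.

Lemma cabsE (R : realType) (c : R[i]) : `|c| = (complex.Re `|c|)%:C.
Proof. by rewrite RRe_real// normr_real. Qed.

Lemma cabsM (R : realType) (c d : R[i]) :
  complex.Re `|c * d| = complex.Re `|c| * complex.Re `|d|.
Proof. by apply: complexI; rewrite rmorphM/= -!cabsE normrM. Qed.

Lemma cabsD (R : realType) (c d : R[i]) :
  complex.Re `|c + d| <= complex.Re `|c| + complex.Re `|d|.
Proof. by rewrite -lecR rmorphD/= -!cabsE ler_normD. Qed.

Lemma cabsJ (R : realType) (c : R[i]) : complex.Re `|c^*| = complex.Re `|c|.
Proof. by rewrite normcJ. Qed.

Lemma cabs_dist (R : realType) (c d : R[i]) :
  `|complex.Re `|c| - complex.Re `|d| | <= complex.Re `|c - d|.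
Proof.
have le (a b : R[i]) : complex.Re `|a| - complex.Re `|b| <= complex.Re `|a - b|.
  by rewrite -lecR rmorphB/= -!cabsE lerB_dist.
by rewrite ler_norml lerNl opprB le distrC le.
Qed.

Lemma cabs_ge_Re (R : realType) (c : R[i]) :
  `|complex.Re c| <= complex.Re `|c|.
Proof. by rewrite -lecR -cabsE normc_ge_Re. Qed.

Lemma cabs_ge_Im (R : realType) (c : R[i]) :
  `|complex.Im c| <= complex.Re `|c|.
Proof.
rewrite normc_def /= -sqrtr_sqr ler_sqrt ?lerDr ?sqr_ge0//.
by rewrite addr_ge0// sqr_ge0.
Qed.

Lemma cabs_le_ReIm (R : realType) (c : R[i]) :
  complex.Re `|c| <= `|complex.Re c| + `|complex.Im c|.
Proof.
have i1 : complex.Re `|'i%C : R[i]| = 1.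
  by rewrite normc_def /= expr0n expr1n add0r sqrtr1.
have real_abs (a : R) : complex.Re `|a%:C| = `|a|.
  by rewrite normc_def /= expr0n addr0 sqrtr_sqr.
rewrite {1}[c]complexE; apply: le_trans (cabsD _ _) _.
by rewrite cabsM i1 mul1r !real_abs.
Qed.

Lemma C_seq_complete (R : realType) (u : nat -> R[i]) :
  (forall e : R, 0 < e -> exists N, forall m n, (N <= m)%N -> (N <= n)%N ->
     complex.Re `|u m - u n| < e) ->
  exists l : R[i], forall e : R, 0 < e ->
    exists N, forall n, (N <= n)%N -> complex.Re `|u n - l| < e.
Proof.
move=> uc.
have /R_seq_complete/cvg_ex[a ua] : forall e : R, 0 < e -> exists N, forall m n,
    (N <= m)%N -> (N <= n)%N -> `|complex.Re (u m) - complex.Re (u n)| < e.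
  move=> e /uc[N NP]; exists N => m n Nm Nn; apply: le_lt_trans (NP _ _ Nm Nn).
  by rewrite -(raddfB (@complex.Re R)) cabs_ge_Re.
have /R_seq_complete/cvg_ex[b ub] : forall e : R, 0 < e -> exists N, forall m n,
    (N <= m)%N -> (N <= n)%N -> `|complex.Im (u m) - complex.Im (u n)| < e.
  move=> e /uc[N NP]; exists N => m n Nm Nn; apply: le_lt_trans (NP _ _ Nm Nn).
  by rewrite -(raddfB (@complex.Im R)) cabs_ge_Im.
exists (a +i* b) => e e0; have e20 := divr_gt0 e0 (ltr0n R 2).
have [N1 _ N1P] := (cvgrPdist_lt _ _).1 ua _ e20.
have [N2 _ N2P] := (cvgrPdist_lt _ _).1 ub _ e20.
exists (maxn N1 N2) => n; rewrite geq_max => /andP[/N1P/= na /N2P/= nb].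
apply: (@le_lt_trans _ _ (`|a - complex.Re (u n)| + `|b - complex.Im (u n)|)).
  apply: le_trans (cabs_le_ReIm _) _.
  by case: (u n) => x y; rewrite /= [leRHS]addrC (distrC a) (distrC b) addrC.
by rewrite (splitr e) ltrD.
Qed.

(* R[i] carries its norm topology through its numFieldType structure. *)
Definition continuousC (R : realType) (X : topologicalType) (f : X -> R[i]) :=
  continuous (f : X -> (R[i] : numFieldType)).

Lemma continuousCP (R : realType) (X : topologicalType) (f : X -> R[i]) :
  continuousC f <-> forall x (e : R), 0 < e ->
    \forall y \near x, complex.Re `|f x - f y| < e.
Proof.
split=> [cf x e e0|cf x].
  have /cvgrPdist_lt/(_ e%:C) := cf x; rewrite ltcR => /(_ e0).
  by apply: filterS => y; rewrite cabsE ltcR.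
apply/cvgrPdist_lt => e /gt0_complex[e0 ->].
by apply: filterS (cf x _ e0) => y; rewrite [X in _ -> X < _]cabsE ltcR.
Qed.

Section ContinuousFunctions.
Variables (R : realType) (X : topologicalType).

Definition continuous_pred : {pred X -> R[i]} :=
  fun f => `[< continuousC f >].

Lemma continuous_predP f : reflect (continuousC f) (f \in continuous_pred).
Proof. exact: asboolP. Qed.

Lemma continuous_submod : submod_closed continuous_pred.
Proof.
split=> [|c f g /continuous_predP cf /continuous_predP cg].
  by apply/continuous_predP => x; exact: cvg_cst.
apply/continuous_predP => x.
exact: (@cvgD (R[i] : numFieldType) (R[i] : numFieldType)^o _ _ _
  (c *: f) g _ _ (cvgM (cvg_cst _) (cf x)) (cg x)).
Qed.
HB.instance Definition _ :=
  GRing.isSubmodClosed.Build R[i] (X -> R[i]) continuous_pred continuous_submod.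

End ContinuousFunctions.

(* C(X) for a compact space X; the proof cX of compactness is a parameter of
   the type because the sup norm satisfies the norm axioms thanks to it. *)
Record contfun (R : realType) (X : topologicalType) (cX : compact [set: X]) :=
  ContFun { cfun_val :> X -> R[i]; _ : cfun_val \in @continuous_pred R X }.

Section ContFun.
Variables (R : realType) (X : topologicalType) (cX : compact [set: X]).
Local Notation CX := (@contfun R X cX).

HB.instance Definition _ := [isSub of CX for @cfun_val R X cX].
HB.instance Definition _ := [Choice of CX by <:].
HB.instance Definition _ := [SubChoice_isSubLmodule of CX by <:].

Implicit Types f g : CX.

Lemma contfun_continuous f : continuousC f.
Proof. by apply/continuous_predP; case: f. Qed.

Lemma contfunP f g : (forall x, f x = g x) -> f = g.
Proof. by move=> fg; apply/val_inj/funext. Qed.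

Lemma contfunD f g x : (f + g) x = f x + g x. Proof. by []. Qed.
Lemma contfunB f g x : (f - g) x = f x - g x. Proof. by []. Qed.
Lemma contfunZ (c : R[i]) f x : (c *: f) x = c * f x. Proof. by []. Qed.

Definition supnorm f : R := sup [set complex.Re `|f x| | x in [set: X]].

Lemma cabs_has_ubound f : has_ubound [set complex.Re `|f x| | x in [set: X]].
Proof.
have cn : continuous (fun x => complex.Re `|f x| : R^o).
  move=> x; apply/cvgrPdist_lt => e e0.
  have := (continuousCP f).1 (@contfun_continuous f) x e e0.
  apply: filterS => y; apply: le_lt_trans; exact: cabs_dist.
have /compact_bounded := continuous_compact (continuous_subspaceT cn) cX.
move=> [M [_ MP]]; exists (M + 1) => _ [x _ <-].
have M1 : M < M + 1 by rewrite ltrDl.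
have /= := MP _ M1 _ (ex_intro2 _ _ x I erefl).
by apply: le_trans; exact: ler_norm.
Qed.

Lemma cabs_le_supnorm f x : complex.Re `|f x| <= supnorm f.
Proof. by apply: ub_le_sup; [exact: cabs_has_ubound|exists x]. Qed.

Lemma supnorm_le f (M : R) : 0 <= M -> (forall x, complex.Re `|f x| <= M) ->
  supnorm f <= M.
Proof.
move=> M0 fM; rewrite /supnorm.
have [->|/set0P ne] := eqVneq [set complex.Re `|f x| | x in [set: X]] set0.
  by rewrite sup0.
by apply: ge_sup => // _ [x _ <-].
Qed.

Lemma supnorm_ge0 f : 0 <= supnorm f.
Proof.
rewrite /supnorm.
have [->|/set0P[_ [x _ _]]] :=
  eqVneq [set complex.Re `|f x| | x in [set: X]] set0; first by rewrite sup0.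
by apply: le_trans (cabs_le_supnorm f x); rewrite -ler0c -cabsE.
Qed.

Lemma supnormD f g : supnorm (f + g) <= supnorm f + supnorm g.
Proof.
apply: supnorm_le => [|x]; first by rewrite addr_ge0// supnorm_ge0.
apply: le_trans (lerD (cabs_le_supnorm f x) (cabs_le_supnorm g x)).
by rewrite -lecR rmorphD/= -!cabsE ler_normD.
Qed.

Lemma supnormZ (c : R[i]) f : supnorm (c *: f) = complex.Re `|c| * supnorm f.
Proof.
apply: (@homogeneous_le _ CX supnorm); first exact: supnorm_ge0.
move=> {}c {}f; have c0 : 0 <= complex.Re `|c| by rewrite -ler0c -cabsE.
apply: supnorm_le => [|x]; first by rewrite mulr_ge0// supnorm_ge0.
by rewrite contfunZ cabsM ler_wpM2l// cabs_le_supnorm.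
Qed.

Lemma supnorm0_eq0 f : supnorm f = 0 -> f = 0.
Proof.
move=> f0; apply: contfunP => x; apply/eqP; rewrite -normr_eq0 cabsE.
have := cabs_le_supnorm f x; rewrite f0 => fx0.
suff -> : complex.Re `|f x| = 0 by [].
by apply/eqP; rewrite eq_le fx0/= -ler0c -cabsE.
Qed.

Let ler_normCXD f g :
  (supnorm (f + g))%:C <= (supnorm f)%:C + (supnorm g)%:C.
Proof. by rewrite -rmorphD/= lecR supnormD. Qed.

Let normCXZ (c : R[i]) f : (supnorm (c *: f))%:C = `|c| * (supnorm f)%:C.
Proof. by rewrite supnormZ rmorphM/= -cabsE. Qed.

Let normCX0_eq0 f : (supnorm f)%:C = 0 -> f = 0.
Proof. by move=> /complexI; exact: supnorm0_eq0. Qed.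

HB.instance Definition _ :=
  Lmodule_isNormed.Build R[i] CX ler_normCXD normCXZ normCX0_eq0.

Lemma rnorm_contfun f : rnorm f = supnorm f.
Proof. by []. Qed.

Let cfun_mul_subproof f g :
  (fun x => f x * g x) \in @continuous_pred R X.
Proof.
apply/continuous_predP => x.
exact: (@cvgM (R[i] : numFieldType) _ _ _ f g _ _
  (@contfun_continuous f x) (@contfun_continuous g x)).
Qed.
Definition cfun_mul f g : CX := ContFun cX (cfun_mul_subproof f g).

Let cfun_conj_subproof f : (fun x => (f x)^*) \in @continuous_pred R X.
Proof.
apply/continuous_predP/continuousCP => x e e0.
apply: filterS ((continuousCP f).1 (@contfun_continuous f) x e e0) => y.
by rewrite -rmorphB cabsJ.
Qed.
Definition cfun_conj f : CX := ContFun cX (cfun_conj_subproof f).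

Lemma cfun_mulE f g x : cfun_mul f g x = f x * g x. Proof. by []. Qed.
Lemma cfun_conjE f x : cfun_conj f x = (f x)^*. Proof. by []. Qed.

Let cfun_mulA : associative cfun_mul.
Proof. by move=> f g h; apply: contfunP => x; exact: mulrA. Qed.
Let cfun_mulDl : left_distributive cfun_mul +%R.
Proof. by move=> f g h; apply: contfunP => x; exact: mulrDl. Qed.
Let cfun_mulDr : right_distributive cfun_mul +%R.
Proof. by move=> f g h; apply: contfunP => x; exact: mulrDr. Qed.
Let cfun_mulZl (c : R[i]) f g : cfun_mul (c *: f) g = c *: cfun_mul f g.
Proof. by apply: contfunP => x; rewrite /= -mulrA. Qed.
Let cfun_mulZr (c : R[i]) f g : cfun_mul f (c *: g) = c *: cfun_mul f g.
Proof. by apply: contfunP => x; exact: mulrCA. Qed.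
Let cfun_conjK : involutive cfun_conj.
Proof. by move=> f; apply: contfunP => x; exact: conjcK. Qed.
Let cfun_conjD : {morph cfun_conj : f g / f + g}.
Proof. by move=> f g; apply: contfunP => x; exact: rmorphD. Qed.
Let cfun_conjZ (c : R[i]) f : cfun_conj (c *: f) = c^* *: cfun_conj f.
Proof. by apply: contfunP => x; exact: rmorphM. Qed.
Let cfun_conjM f g :
  cfun_conj (cfun_mul f g) = cfun_mul (cfun_conj g) (cfun_conj f).
Proof. by apply: contfunP => x; rewrite /= rmorphM mulrC. Qed.

HB.instance Definition _ := isStarAlgebra.Build R CX cfun_mulA cfun_mulDl
  cfun_mulDr cfun_mulZl cfun_mulZr cfun_conjK cfun_conjD cfun_conjZ cfun_conjM.

Let cfun_normM f g : `|f ** g| <= `|f| * `|g|.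
Proof.
rewrite !rnormE -rmorphM/= lecR; apply: supnorm_le => [|x].
  by rewrite mulr_ge0// supnorm_ge0.
rewrite (_ : (f ** g) x = f x * g x)// cabsM.
by rewrite ler_pM ?cabs_le_supnorm// -ler0c -cabsE.
Qed.
HB.instance Definition _ := isNormedStarAlgebra.Build R CX cfun_normM.

Let cfun_complete (F : set_system CX) : ProperFilter F -> cauchy F -> cvg F.
Proof.
apply: seq_complete => u uc.
have dist_le m n x : complex.Re `|u m x - u n x| <= rnorm (u m - u n).
  exact: (cabs_le_supnorm (u m - u n) x).
have uxc x : exists l : R[i], forall e : R, 0 < e ->
    exists N, forall n, (N <= n)%N -> complex.Re `|u n x - l| < e.
  apply: C_seq_complete => e /uc[N NP]; exists N => m n Nm Nn.
  exact: le_lt_trans (dist_le _ _ _) (NP _ _ Nm Nn).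
have /choice[l ul] := uxc.
have ull (e : R) : 0 < e -> exists N, forall n, (N <= n)%N -> forall x,
    complex.Re `|u n x - l x| <= e.
  move=> e0; have e20 := divr_gt0 e0 (ltr0n R 2).
  have [N NP] := uc _ e20; exists N => n Nn x.
  have [M MP] := ul x _ e20.
  have -> : u n x - l x = (u n x - u (maxn M N) x) + (u (maxn M N) x - l x).
    by rewrite addrA subrK.
  apply: le_trans (cabsD _ _) _; rewrite (splitr e) lerD// ltW//.
    by apply: le_lt_trans (dist_le _ _ _) (NP _ _ _ _); rewrite ?leq_maxr.
  by apply: MP; rewrite leq_maxl.
have lc : l \in @continuous_pred R X.
  apply/continuous_predP/continuousCP => x e e0.
  have e30 : 0 < e / 3 by rewrite divr_gt0// ltr0n.
  have [N /(_ N (leqnn N)) NP] := ull _ e30.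
  apply: filterS ((continuousCP (u N)).1 (@contfun_continuous (u N)) x _ e30).
  move=> y xy.
  have -> : l x - l y = (l x - u N x) + ((u N x - u N y) + (u N y - l y)).
    by rewrite !subrKA.
  have e3 : e / 3 + (e / 3 + e / 3) = e.
    by lra.
  rewrite -e3; apply: le_lt_trans (cabsD _ _) _; apply: ler_ltD.
    by rewrite distrC; exact: NP.
  by apply: le_lt_trans (cabsD _ _) _; apply: ltr_leD; [exact: xy|exact: NP].
exists (ContFun cX lc) => e e0; have [N NP] := ull _ (divr_gt0 e0 (ltr0n R 2)).
exists N => n /NP un; apply: (@le_lt_trans _ _ (e / 2)).
  by apply: supnorm_le => [|x]; [rewrite ltW// divr_gt0|exact: un].
by rewrite ltr_pdivrMr// ltr_pMr// ltr1n.
Qed.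
HB.instance Definition _ := Uniform_isComplete.Build CX cfun_complete.

Let cfun_norm_star f : `|star f ** f| = `|f| ^+ 2.
Proof.
have sfE x : complex.Re `|(star f ** f) x| = complex.Re `|f x| ^+ 2.
  by rewrite (_ : (star f ** f) x = (f x)^* * f x)// cabsM cabsJ expr2.
rewrite !rnormE -rmorphXn/=; congr (_%:C); rewrite !rnorm_contfun.
apply/eqP; rewrite eq_le; apply/andP; split.
  apply: supnorm_le => [|x]; first by rewrite exprn_ge0// supnorm_ge0.
  by rewrite sfE ler_sqr ?nnegrE ?supnorm_ge0 ?cabs_le_supnorm// -ler0c -cabsE.
rewrite -ler_sqrt ?exprn_ge0 ?supnorm_ge0// sqrtr_sqr ger0_norm ?supnorm_ge0//.
apply: supnorm_le => [|x]; first exact: sqrtr_ge0.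
have fx0 : 0 <= complex.Re `|f x| by rewrite -ler0c -cabsE.
by rewrite -[leLHS]ger0_norm// -sqrtr_sqr ler_sqrt ?supnorm_ge0// -sfE cabs_le_supnorm.
Qed.
HB.instance Definition _ := isCStarAlgebra.Build R CX cfun_norm_star.

End ContFun.

(* Two-sided *-ideals. For closed two-sided ideals of C*-algebras the last
   field is automatic; it is required here so that the involution descends
   to the quotient of an arbitrary *-algebra. *)
Record star_ideal (R : realType) (V : starAlgType R) := StarIdeal {
  ideal_set :> V -> Prop;
  ideal0 : ideal_set 0;
  idealD : forall x y, ideal_set x -> ideal_set y -> ideal_set (x + y);
  idealZ : forall (c : R[i]) x, ideal_set x -> ideal_set (c *: x);
  idealMl : forall x y, ideal_set y -> ideal_set (x ** y);
  idealMr : forall x y, ideal_set x -> ideal_set (x ** y);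
  ideal_star : forall x, ideal_set x -> ideal_set (star x)
}.

Section StarQuotient.
Variables (R : realType) (V : starAlgType R) (J : star_ideal V).
Implicit Types x y z : V.

Definition ideal_pred : {pred V} := fun x => `[< J x >].

Let ideal_zmod_closed : zmod_closed ideal_pred.
Proof.
split=> [|x y /asboolP Jx /asboolP Jy]; apply/asboolP; first exact: ideal0.
by apply: idealD => //; rewrite -scaleN1r; exact: idealZ.
Qed.
HB.instance Definition _ := GRing.isZmodClosed.Build V ideal_pred ideal_zmod_closed.

(* The algebraic quotient V / J; the *-algebra operations are induced from
   those of V, see starquot_piZ, starquot_piM and starquot_piS. *)
Definition starquot : Type := Quotient.quot ideal_pred.
HB.instance Definition _ := GRing.Zmodule.on starquot.

Definition starquot_pi (x : V) : starquot := \pi_(Quotient.quot ideal_pred)%qT x.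
Local Notation pi := starquot_pi.

Lemma starquot_eqP x y : pi x = pi y <-> J (x - y).
Proof.
rewrite /starquot_pi; split=> [/eqP|Jxy]; last apply/eqP;
  by rewrite -Quotient.idealrBE => *; apply/asboolP.
Qed.

Lemma starquot_surj (q : starquot) : exists x, pi x = q.
Proof. by exists (repr (q : Quotient.quot ideal_pred)); rewrite /starquot_pi reprK. Qed.

Lemma starquot_piB x y : pi (x - y) = pi x - pi y.
Proof. by rewrite /starquot_pi !piE. Qed.

HB.instance Definition _ :=
  GRing.isZmodMorphism.Build V starquot starquot_pi starquot_piB.

Definition starquot_repr (q : starquot) : V := repr (q : Quotient.quot ideal_pred).

Lemma starquot_reprK q : pi (starquot_repr q) = q.
Proof. by rewrite /starquot_pi reprK. Qed.

Definition starquot_scale (c : R[i]) q := pi (c *: starquot_repr q).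
Definition starquot_mul q r := pi (starquot_repr q ** starquot_repr r).
Definition starquot_star q := pi (star (starquot_repr q)).

Let J_repr x : J (starquot_repr (pi x) - x).
Proof. by apply/starquot_eqP; rewrite starquot_reprK. Qed.

Lemma amulBl x y z : (x - y) ** z = x ** z - y ** z.
Proof. by rewrite amulDl -scaleN1r amulZl scaleN1r. Qed.
Lemma amulBr x y z : x ** (y - z) = x ** y - x ** z.
Proof. by rewrite amulDr -scaleN1r amulZr scaleN1r. Qed.
Lemma starB x y : star (x - y) = star x - star y.
Proof. by rewrite starD -scaleN1r starZ rmorphN1 scaleN1r. Qed.

Lemma starquot_piZ (c : R[i]) x : pi (c *: x) = starquot_scale c (pi x).
Proof.
apply/esym/starquot_eqP; rewrite -scalerBr; apply: idealZ; exact: J_repr.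
Qed.
Lemma starquot_piM x y : pi (x ** y) = starquot_mul (pi x) (pi y).
Proof.
apply/esym/starquot_eqP.
rewrite -(subrKA (x ** starquot_repr (pi y))) -amulBl -amulBr.
by apply: idealD; [apply: idealMr|apply: idealMl]; exact: J_repr.
Qed.
Lemma starquot_piS x : pi (star x) = starquot_star (pi x).
Proof.
apply/esym/starquot_eqP; rewrite -starB; apply: ideal_star; exact: J_repr.
Qed.

Let scaleA (a b : R[i]) q :
  starquot_scale a (starquot_scale b q) = starquot_scale (a * b) q.
Proof. by have [x <-] := starquot_surj q; rewrite -!starquot_piZ scalerA. Qed.
Let scale1 q : starquot_scale 1 q = q.
Proof. by have [x <-] := starquot_surj q; rewrite -starquot_piZ scale1r. Qed.
Let scaleDr : right_distributive starquot_scale +%R.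
Proof.
move=> c q r; have [x <-] := starquot_surj q; have [y <-] := starquot_surj r.
by rewrite -raddfD -!starquot_piZ scalerDr raddfD.
Qed.
Let scaleDl q : {morph starquot_scale^~ q : a b / a + b}.
Proof.
move=> a b; have [x <-] := starquot_surj q.
by rewrite -!starquot_piZ scalerDl raddfD.
Qed.
HB.instance Definition _ := GRing.Zmodule_isLmodule.Build R[i] starquot
  scaleA scale1 scaleDr scaleDl.
HB.instance Definition _ := GRing.isScalable.Build R[i] V starquot *:%R
  starquot_pi starquot_piZ.

Let mulA : associative starquot_mul.
Proof.
move=> q r s; have [x <-] := starquot_surj q; have [y <-] := starquot_surj r.
by have [z <-] := starquot_surj s; rewrite -!starquot_piM amulA.
Qed.
Let mulDl : left_distributive starquot_mul +%R.
Proof.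
move=> q r s; have [x <-] := starquot_surj q; have [y <-] := starquot_surj r.
have [z <-] := starquot_surj s.
by rewrite -raddfD -!starquot_piM amulDl raddfD.
Qed.
Let mulDr : right_distributive starquot_mul +%R.
Proof.
move=> q r s; have [x <-] := starquot_surj q; have [y <-] := starquot_surj r.
have [z <-] := starquot_surj s.
by rewrite -raddfD -!starquot_piM amulDr raddfD.
Qed.
Let mulZl (c : R[i]) q r : starquot_mul (c *: q) r = c *: starquot_mul q r.
Proof.
have [x <-] := starquot_surj q; have [y <-] := starquot_surj r.
by rewrite -linearZ -!starquot_piM amulZl linearZ.
Qed.
Let mulZr (c : R[i]) q r : starquot_mul q (c *: r) = c *: starquot_mul q r.
Proof.
have [x <-] := starquot_surj q; have [y <-] := starquot_surj r.
by rewrite -linearZ -!starquot_piM amulZr linearZ.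
Qed.
Let qstarK : involutive starquot_star.
Proof.
by move=> q; have [x <-] := starquot_surj q; rewrite -!starquot_piS starK.
Qed.
Let qstarD : {morph starquot_star : q r / q + r}.
Proof.
move=> q r; have [x <-] := starquot_surj q; have [y <-] := starquot_surj r.
by rewrite -raddfD -!starquot_piS starD raddfD.
Qed.
Let qstarZ (c : R[i]) q : starquot_star (c *: q) = c^* *: starquot_star q.
Proof.
have [x <-] := starquot_surj q.
by rewrite -linearZ -!starquot_piS starZ linearZ.
Qed.
Let qstarM q r :
  starquot_star (starquot_mul q r) = starquot_mul (starquot_star r) (starquot_star q).
Proof.
have [x <-] := starquot_surj q; have [y <-] := starquot_surj r.
by rewrite -starquot_piM -!starquot_piS -starquot_piM starM.
Qed.
HB.instance Definition _ := isStarAlgebra.Build R starquot mulA mulDl mulDr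
  mulZl mulZr qstarK qstarD qstarZ qstarM.

End StarQuotient.

Record closed_ideal (R : realType) (B : normedStarAlgType R) := ClosedIdeal {
  closed_ideal_ideal :> star_ideal B;
  closed_idealP : closed [set x | closed_ideal_ideal x]
}.

Definition quotient (R : realType) (B : normedStarAlgType R)
  (J : closed_ideal B) : Type := starquot J.

Section NormedQuotient.
Variables (R : realType) (B : normedStarAlgType R) (J : closed_ideal B).
Local Notation BJ := (quotient J).

HB.instance Definition _ := StarAlgebra.on BJ.

Definition quotient_pi : B -> BJ := @starquot_pi R B J.
HB.instance Definition _ := GRing.Linear.on quotient_pi.

(* B / J with the norm of b + J defined as the infimum of the norms of its
   elements. When B is a C*-algebra so is B / J, but the notion of cpc map into
   B / J only needs its structure of normed *-algebra. *)
Definition quotient_norm (q : BJ) : R := inf [set rnorm x | x in [set x | quotient_pi x = q]].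

Implicit Types (q r : BJ) (x y : B).

Lemma quotient_surj q : exists x, quotient_pi x = q.
Proof. exact: starquot_surj. Qed.

Lemma quotient_piM x y : quotient_pi (x ** y) = quotient_pi x ** quotient_pi y.
Proof. exact: starquot_piM. Qed.

Let norm_set q : set R := [set rnorm x | x in [set x | quotient_pi x = q]].

Let norm_lb q : has_lbound (norm_set q).
Proof. by exists 0 => _ [x _ <-]; exact: rnorm_ge0. Qed.

Let norm_ne q : norm_set q !=set0.
Proof. by have [x xq] := quotient_surj q; exists (rnorm x), x. Qed.

Lemma quotient_norm_le x : quotient_norm (quotient_pi x) <= rnorm x.
Proof. by apply: ge_inf; [exact: norm_lb|exists x]. Qed.

Lemma quotient_norm_ge q (M : R) :
  (forall x, quotient_pi x = q -> M <= rnorm x) -> M <= quotient_norm q.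
Proof. by move=> Mq; apply: lb_le_inf; [exact: norm_ne|move=> _ [x /Mq ? <-]]. Qed.

Lemma quotient_norm_ge0 q : 0 <= quotient_norm q.
Proof. by apply: quotient_norm_ge => x _; exact: rnorm_ge0. Qed.

Let quotient_norm_geM q (M c : R) : 0 <= c ->
  (forall x, quotient_pi x = q -> M <= c * rnorm x) -> M <= c * quotient_norm q.
Proof.
rewrite le_eqVlt => /predU1P[<-|c0] Mq.
  by have [x /Mq] := quotient_surj q; rewrite !mul0r.
rewrite mulrC -ler_pdivrMr//; apply: quotient_norm_ge => x /Mq.
by rewrite ler_pdivrMr// mulrC.
Qed.

Lemma quotient_normD q r :
  quotient_norm (q + r) <= quotient_norm q + quotient_norm r.
Proof.
rewrite -lerBlDr; apply: quotient_norm_ge => x <-.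
rewrite lerBlDl -lerBlDr; apply: quotient_norm_ge => y <-.
rewrite lerBlDr addrC -raddfD; apply: le_trans (quotient_norm_le _) _.
exact: rnormD.
Qed.

Lemma quotient_normZ (c : R[i]) q :
  quotient_norm (c *: q) = complex.Re `|c| * quotient_norm q.
Proof.
apply: (@homogeneous_le _ BJ quotient_norm); first exact: quotient_norm_ge0.
move=> {}c {}q; apply: quotient_norm_geM => [|x <-].
  by rewrite -ler0c -cabsE.
by rewrite -rnormZ -linearZ quotient_norm_le.
Qed.

Lemma quotient_norm0_eq0 q : quotient_norm q = 0 -> q = 0.
Proof.
have [x <-] := quotient_surj q => qx0.
rewrite -(raddf0 quotient_pi); apply/starquot_eqP; rewrite subr0.
have : closure [set x | J x] x.
  move=> U /nbhs_ballP[e /= /gt0_complex[e0 eE] xeU].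
  have [|_ [y yx <-]] := @inf_adherent _ (norm_set (quotient_pi x)) _ e0.
    by split; [exact: norm_ne|exact: norm_lb].
  rewrite -/(quotient_norm _) qx0 add0r => ye.
  exists (x - y); split; first exact/starquot_eqP/esym.
  by apply: xeU; rewrite -ball_normE /ball_/= opprB addrC subrK eE lt_rnorm.
by rewrite -(closure_id _).1//; exact: closed_idealP.
Qed.

Lemma quotient_normM q r : quotient_norm (q ** r) <= quotient_norm q * quotient_norm r.
Proof.
apply: quotient_norm_geM => [|y <-]; first exact: quotient_norm_ge0.
rewrite mulrC; apply: quotient_norm_geM => [|x <-]; first exact: rnorm_ge0.
rewrite -quotient_piM mulrC; apply: le_trans (quotient_norm_le _) _.
by rewrite -lecR rmorphM/= -!rnormE normaM.
Qed.

Let normD q r :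
  (quotient_norm (q + r))%:C <= (quotient_norm q)%:C + (quotient_norm r)%:C.
Proof. by rewrite -rmorphD/= lecR quotient_normD. Qed.
Let normZ (c : R[i]) q : (quotient_norm (c *: q))%:C = `|c| * (quotient_norm q)%:C.
Proof. by rewrite quotient_normZ rmorphM/= -cabsE. Qed.
Let norm0_eq0 q : (quotient_norm q)%:C = 0 -> q = 0.
Proof. by move=> /complexI; exact: quotient_norm0_eq0. Qed.
HB.instance Definition _ := Lmodule_isNormed.Build R[i] BJ normD normZ norm0_eq0.

Let normM q r : `|q ** r| <= `|q| * `|r|.
Proof. by rewrite !rnormE -rmorphM/= lecR quotient_normM. Qed.
HB.instance Definition _ := isNormedStarAlgebra.Build R BJ normM.

End NormedQuotient.

(* The Hausdorff completion of a *-algebra V for a C*-seminorm p is the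
   quotient of the *-algebra of p-Cauchy sequences by the null sequences. *)
Record cstar_seminorm (R : realType) (V : starAlgType R) := CStarSeminorm {
  seminorm :> V -> R;
  seminorm_ge0 : forall x, 0 <= seminorm x;
  seminormD : forall x y, seminorm (x + y) <= seminorm x + seminorm y;
  seminormZ : forall (c : R[i]) x,
    seminorm (c *: x) = complex.Re `|c| * seminorm x;
  seminormM : forall x y, seminorm (x ** y) <= seminorm x * seminorm y;
  seminorm_star : forall x, seminorm (star x ** x) = seminorm x ^+ 2
}.

Section SeminormTheory.
Variables (R : realType) (V : starAlgType R) (p : cstar_seminorm V).
Implicit Types x y : V.

Lemma seminorm0 : p 0 = 0.
Proof. by rewrite -(scale0r (0 : V)) seminormZ normr0 mul0r. Qed.

Lemma seminormN x : p (- x) = p x.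
Proof. by rewrite -scaleN1r seminormZ normrN1 mul1r. Qed.

Lemma seminormB x y : p (x - y) = p (y - x).
Proof. by rewrite -seminormN opprB. Qed.

Lemma seminorm_dist x y : `|p x - p y| <= p (x - y).
Proof.
have le a b : p a - p b <= p (a - b).
  by rewrite lerBlDr -{1}(subrK b a) seminormD.
by rewrite ler_norml lerNl opprB le seminormB le.
Qed.

Lemma seminormS x : p (star x) = p x.
Proof.
have le y : p y <= p (star y).
  have := seminormM p (star y) y; rewrite seminorm_star expr2.
  have := seminorm_ge0 p y; rewrite le_eqVlt => /predU1P[<- _|y0].
    exact: seminorm_ge0.
  by rewrite ler_pM2r.
by apply/eqP; rewrite eq_le le -{2}(starK x) le.
Qed.

End SeminormTheory.

Section CauchySequences.
Variables (R : realType) (V : starAlgType R) (p : cstar_seminorm V).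

Definition cauchy_pred : {pred nat -> V} := fun u => `[< seq_cauchy p u >].

Let cauchy_submod : submod_closed cauchy_pred.
Proof.
split=> [|c u v /asboolP uc /asboolP vc]; apply/asboolP => e e0.
  by exists 0%N => m n _ _; rewrite subrr seminorm0.
have e20 := divr_gt0 e0 (ltr0n R 2).
have c0 : 0 <= complex.Re `|c| by rewrite -ler0c -cabsE.
have c1 : 0 < complex.Re `|c| + 1 by rewrite ltr_wpDl.
have [N NP] := uc _ (divr_gt0 e20 c1); have [M MP] := vc _ e20.
exists (maxn N M) => m n; rewrite !geq_max => /andP[Nm Mm] /andP[Nn Mn].
have -> : (c *: u + v) m - (c *: u + v) n = c *: (u m - u n) + (v m - v n).
  by rewrite /= opprD addrACA scalerBr.
apply: le_lt_trans (seminormD _ _ _) _; rewrite (splitr e) ler_ltD ?MP//.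
rewrite seminormZ (@le_trans _ _ ((complex.Re `|c| + 1) * p (u m - u n)))//.
  by rewrite ler_wpM2r ?seminorm_ge0// lerDl.
by rewrite mulrC -ler_pdivlMr// ltW// NP.
Qed.
HB.instance Definition _ :=
  GRing.isSubmodClosed.Build R[i] (nat -> V) cauchy_pred cauchy_submod.

Record cauchy_sequence := CauchySequence {
  cauchy_val :> nat -> V; _ : cauchy_val \in cauchy_pred }.
Local Notation W := cauchy_sequence.

HB.instance Definition _ := [isSub of W for cauchy_val].
HB.instance Definition _ := [Choice of W by <:].
HB.instance Definition _ := [SubChoice_isSubLmodule of W by <:].

Implicit Types u v w : W.

Lemma cauchy_sequenceP u : seq_cauchy p u.
Proof. by apply/asboolP; case: u. Qed.

Lemma cauchy_ext u v : (forall n, u n = v n) -> u = v.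
Proof. by move=> uv; apply/val_inj/funext. Qed.

Lemma cauchy_bounded u : exists2 M : R, 0 < M & forall n, p (u n) <= M.
Proof.
have [N NP] := cauchy_sequenceP u ltr01.
pose M := \sum_(i < N) p (u i) + p (u N) + 1.
have s0 : 0 <= \sum_(i < N) p (u i) by rewrite sumr_ge0// => *; exact: seminorm_ge0.
have uN0 : 0 <= p (u N) by exact: seminorm_ge0.
exists M => [|n]; first by rewrite ltr_wpDl// addr_ge0.
have [nN|Nn] := ltnP n N.
  rewrite /M (bigD1 (Ordinal nN))//= -!addrA lerDl !addr_ge0//.
  by rewrite sumr_ge0// => *; exact: seminorm_ge0.
rewrite -[u n](subrK (u N)); apply: le_trans (seminormD _ _ _) _.
by have := NP n N Nn (leqnn N); rewrite /M; lra.
Qed.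

Let mul_subproof u v : (fun n => u n ** v n) \in cauchy_pred.
Proof.
apply/asboolP => e e0; have e20 := divr_gt0 e0 (ltr0n R 2).
have [Mu Mu0 uM] := cauchy_bounded u; have [Mv Mv0 vM] := cauchy_bounded v.
have [N NP] := cauchy_sequenceP u (divr_gt0 e20 Mv0).
have [M MP] := cauchy_sequenceP v (divr_gt0 e20 Mu0).
exists (maxn N M) => m n; rewrite !geq_max => /andP[Nm Mm] /andP[Nn Mn].
rewrite -(subrKA (u n ** v m)) -amulBl -amulBr.
apply: le_lt_trans (seminormD _ _ _) _; rewrite (splitr e) ltrD//.
  apply: le_lt_trans (seminormM _ _ _) _.
  apply: (@le_lt_trans _ _ (p (u m - u n) * Mv)).
    by rewrite ler_wpM2l// seminorm_ge0.
  by rewrite -ltr_pdivlMr// NP.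
apply: le_lt_trans (seminormM _ _ _) _.
apply: (@le_lt_trans _ _ (Mu * p (v m - v n))).
  by rewrite ler_wpM2r// seminorm_ge0.
by rewrite mulrC -ltr_pdivlMr// MP.
Qed.
Definition cauchy_mul u v : W := CauchySequence (mul_subproof u v).

Let star_subproof u : (fun n => star (u n)) \in cauchy_pred.
Proof.
apply/asboolP => e /(cauchy_sequenceP u)[N NP]; exists N => m n Nm Nn.
by rewrite -starB seminormS NP.
Qed.
Definition cauchy_star u : W := CauchySequence (star_subproof u).

Let mulA : associative cauchy_mul.
Proof. by move=> u v w; apply: cauchy_ext => n; exact: amulA. Qed.
Let mulDl : left_distributive cauchy_mul +%R.
Proof. by move=> u v w; apply: cauchy_ext => n; exact: amulDl. Qed.
Let mulDr : right_distributive cauchy_mul +%R.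
Proof. by move=> u v w; apply: cauchy_ext => n; exact: amulDr. Qed.
Let mulZl (c : R[i]) u v : cauchy_mul (c *: u) v = c *: cauchy_mul u v.
Proof. by apply: cauchy_ext => n; exact: amulZl. Qed.
Let mulZr (c : R[i]) u v : cauchy_mul u (c *: v) = c *: cauchy_mul u v.
Proof. by apply: cauchy_ext => n; exact: amulZr. Qed.
Let cstarK : involutive cauchy_star.
Proof. by move=> u; apply: cauchy_ext => n; exact: starK. Qed.
Let cstarD : {morph cauchy_star : u v / u + v}.
Proof. by move=> u v; apply: cauchy_ext => n; exact: starD. Qed.
Let cstarZ (c : R[i]) u : cauchy_star (c *: u) = c^* *: cauchy_star u.
Proof. by apply: cauchy_ext => n; exact: starZ. Qed.
Let cstarM u v :
  cauchy_star (cauchy_mul u v) = cauchy_mul (cauchy_star v) (cauchy_star u).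
Proof. by apply: cauchy_ext => n; exact: starM. Qed.
HB.instance Definition _ := isStarAlgebra.Build R W mulA mulDl mulDr
  mulZl mulZr cstarK cstarD cstarZ cstarM.

Lemma cauchy_cvg_norm u : cvgn (fun n => p (u n)).
Proof.
apply: R_seq_complete => e /(cauchy_sequenceP u)[N NP]; exists N => m n Nm Nn.
exact: le_lt_trans (seminorm_dist _ _ _) (NP _ _ Nm Nn).
Qed.

Definition limit_norm u : R := limn (fun n => p (u n)).

Lemma limit_norm_ge0 u : 0 <= limit_norm u.
Proof.
by apply: limr_ge; [exact: cauchy_cvg_norm|apply: nearW => n; exact: seminorm_ge0].
Qed.

Lemma limit_normD u v : limit_norm (u + v) <= limit_norm u + limit_norm v.
Proof.
rewrite /limit_norm -limD; [|exact: cauchy_cvg_norm|exact: cauchy_cvg_norm].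
apply: ler_lim; first exact: cauchy_cvg_norm.
  by apply: is_cvgD; exact: cauchy_cvg_norm.
by apply: nearW => n; exact: seminormD.
Qed.

Lemma limit_normZ (c : R[i]) u : limit_norm (c *: u) = complex.Re `|c| * limit_norm u.
Proof.
have -> : limit_norm (c *: u) = limn (fun n => complex.Re `|c| * p (u n)).
  by congr (limn _); apply/funext => n; exact: seminormZ.
apply/cvg_lim => //; apply: cvgM; [exact: cvg_cst|exact: cauchy_cvg_norm].
Qed.

Lemma limit_normM u v : limit_norm (u ** v) <= limit_norm u * limit_norm v.
Proof.
rewrite /limit_norm -limM; [|exact: cauchy_cvg_norm|exact: cauchy_cvg_norm].
apply: ler_lim; first exact: cauchy_cvg_norm.
  by apply: is_cvgM; exact: cauchy_cvg_norm.
by apply: nearW => n; exact: seminormM.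
Qed.

Lemma limit_norm_star u : limit_norm (star u ** u) = limit_norm u ^+ 2.
Proof.
have -> : limit_norm (star u ** u) = limn (fun n => p (u n) * p (u n)).
  by congr (limn _); apply/funext => n; exact: (seminorm_star p (u n)).
by apply/cvg_lim => //; apply: cvgM; exact: cauchy_cvg_norm.
Qed.

Definition null_sequence u : Prop := limit_norm u = 0.

Lemma limit_norm_le u (M : R) N :
  (forall n, (N <= n)%N -> p (u n) <= M) -> limit_norm u <= M.
Proof.
by move=> uM; apply: limr_le; [exact: cauchy_cvg_norm|exists N].
Qed.

Let null0 : null_sequence 0.
Proof.
apply/eqP; rewrite eq_le limit_norm_ge0 andbT.
by apply: (@limit_norm_le _ _ 0) => n _; rewrite [p _]seminorm0.
Qed.
Let nullD u v : null_sequence u -> null_sequence v -> null_sequence (u + v).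
Proof.
rewrite /null_sequence => u0 v0; apply/eqP; rewrite eq_le limit_norm_ge0 andbT.
by rewrite (le_trans (limit_normD _ _))// u0 v0 addr0.
Qed.
Let nullZ (c : R[i]) u : null_sequence u -> null_sequence (c *: u).
Proof. by rewrite /null_sequence limit_normZ => ->; rewrite mulr0. Qed.
Let nullMl u v : null_sequence v -> null_sequence (u ** v).
Proof.
rewrite /null_sequence => v0; apply/eqP; rewrite eq_le limit_norm_ge0 andbT.
by rewrite (le_trans (limit_normM _ _))// v0 mulr0.
Qed.
Let nullMr u v : null_sequence u -> null_sequence (u ** v).
Proof.
rewrite /null_sequence => u0; apply/eqP; rewrite eq_le limit_norm_ge0 andbT.
by rewrite (le_trans (limit_normM _ _))// u0 mul0r.
Qed.
Let nullS u : null_sequence u -> null_sequence (star u).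
Proof.
rewrite /null_sequence => <-; congr (limn _); apply/funext => n.
exact: seminormS.
Qed.
Definition null_ideal : star_ideal W :=
  StarIdeal null0 nullD nullZ nullMl nullMr nullS.

End CauchySequences.

Definition completion (R : realType) (V : starAlgType R)
  (p : cstar_seminorm V) : Type := starquot (null_ideal p).

Section Completion.
Variables (R : realType) (V : starAlgType R) (p : cstar_seminorm V).
Local Notation E := (completion p).
Local Notation W := (cauchy_sequence p).

HB.instance Definition _ := StarAlgebra.on E.

Definition completion_class : W -> E := @starquot_pi R W (null_ideal p).
HB.instance Definition _ := GRing.Linear.on completion_class.
Local Notation pi := completion_class.

Lemma completion_surj (q : E) : exists u, pi u = q.
Proof. exact: starquot_surj. Qed.

Let completion_piM u v : pi (u ** v) = pi u ** pi v.
Proof. exact: starquot_piM. Qed.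
Let completion_piS u : pi (star u) = star (pi u).
Proof. exact: starquot_piS. Qed.

Definition completion_norm (q : E) : R := limit_norm (starquot_repr q).

Lemma completion_normE u : completion_norm (pi u) = limit_norm u.
Proof.
have le v w : pi v = pi w -> limit_norm v <= limit_norm w.
  move=> /starquot_eqP/= vw; rewrite -{1}(subrK w v).
  by rewrite (le_trans (limit_normD _ _))// [limit_norm (_ - _)]vw add0r.
have uu : pi (starquot_repr (pi u)) = pi u by exact: starquot_reprK.
by apply/eqP; rewrite eq_le !le.
Qed.

Let normD (q r : E) :
  (completion_norm (q + r))%:C <= (completion_norm q)%:C + (completion_norm r)%:C.
Proof.
have [u <-] := completion_surj q; have [v <-] := completion_surj r.
by rewrite -rmorphD/= lecR -raddfD !completion_normE limit_normD.
Qed.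
Let normZ (c : R[i]) (q : E) :
  (completion_norm (c *: q))%:C = `|c| * (completion_norm q)%:C.
Proof.
have [u <-] := completion_surj q.
by rewrite -linearZ !completion_normE limit_normZ rmorphM/= -cabsE.
Qed.
Let norm0_eq0 (q : E) : (completion_norm q)%:C = 0 -> q = 0.
Proof.
have [u <-] := completion_surj q => /complexI; rewrite completion_normE => u0.
by rewrite -(raddf0 pi); apply/starquot_eqP; rewrite subr0.
Qed.
HB.instance Definition _ := Lmodule_isNormed.Build R[i] E normD normZ norm0_eq0.

Lemma rnorm_completion u : rnorm (pi u) = limit_norm u.
Proof. exact: completion_normE. Qed.

Let normM (q r : E) : `|q ** r| <= `|q| * `|r|.
Proof.
have [u <-] := completion_surj q; have [v <-] := completion_surj r.
by rewrite -completion_piM !rnormE !rnorm_completion -rmorphM/= lecR limit_normM.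
Qed.
HB.instance Definition _ := isNormedStarAlgebra.Build R E normM.

Let norm_star (q : E) : `|star q ** q| = `|q| ^+ 2.
Proof.
have [u <-] := completion_surj q.
by rewrite -completion_piS -completion_piM !rnormE !rnorm_completion
  limit_norm_star rmorphXn.
Qed.

Let cst_subproof (x : V) : (fun=> x) \in cauchy_pred p.
Proof.
by apply/asboolP => e e0; exists 0%N => m n _ _; rewrite subrr seminorm0.
Qed.
Definition cauchy_cst (x : V) : W := CauchySequence (cst_subproof x).

Definition completion_in (x : V) : E := pi (cauchy_cst x).

Let complete (F : set_system E) : ProperFilter F -> cauchy F -> cvg F.
Proof.
apply: seq_complete => q qc.
have /choice[u uq] := fun k => completion_surj (q k).
have k0 k : 0 < (k.+1%:R^-1 : R) by rewrite invr_gt0 ltr0n.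
have /choice[N NP] : forall k, exists N, forall m n, (N <= m)%N -> (N <= n)%N ->
    p (u k m - u k n) < k.+1%:R^-1.
  by move=> k; exact: cauchy_sequenceP.
pose v k := u k (N k).
have qv k : rnorm (q k - completion_in (v k)) <= k.+1%:R^-1.
  rewrite -uq -raddfB rnorm_completion; apply: (@limit_norm_le _ _ _ _ _ (N k)).
  by move=> n Nn; rewrite ltW//; exact: NP.
have vE x y : rnorm (completion_in x - completion_in y) = p (x - y).
  rewrite -raddfB rnorm_completion.
  have -> : limit_norm (cauchy_cst x - cauchy_cst y) = limn (fun=> p (x - y)) by [].
  exact: lim_cst.
have small (e : R) : 0 < e -> exists N, forall n, (N <= n)%N ->
    (n.+1%:R^-1 : R) < e.
  move=> e0; have [M _ MP] := near_infty_natSinv_lt (PosNum e0).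
  by exists M => n /MP.
have vc : v \in cauchy_pred p.
  apply/asboolP => e e0; have e30 : 0 < e / 3 by rewrite divr_gt0// ltr0n.
  have [M MP] := small _ e30; have [L LP] := qc _ e30.
  exists (maxn M L) => m n; rewrite !geq_max => /andP[Mm Lm] /andP[Mn Ln].
  rewrite -vE -(subrKA (q m)) -(subrKA (q n) (q m)).
  have e3 : e / 3 + (e / 3 + e / 3) = e by lra.
  rewrite -e3; apply: le_lt_trans (rnormD _ _) _; apply: ltrD.
    by rewrite rnormB; apply: le_lt_trans (qv m) (MP _ Mm).
  apply: le_lt_trans (rnormD _ _) _; apply: ltrD; first exact: LP.
  exact: le_lt_trans (qv n) (MP _ Mn).
exists (pi (CauchySequence vc)) => e e0; have e20 := divr_gt0 e0 (ltr0n R 2).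
have [M MP] := small _ e20.
have [L LP] := cauchy_sequenceP (CauchySequence vc) (divr_gt0 e20 (ltr0n R 2)).
exists (maxn M L) => n; rewrite geq_max => /andP[Mn Ln].
rewrite -(subrKA (completion_in (v n))).
apply: le_lt_trans (rnormD _ _) _; rewrite (splitr e) ltrD//.
  exact: le_lt_trans (qv n) (MP _ Mn).
apply: (@le_lt_trans _ _ (e / 2 / 2)); last by lra.
rewrite -raddfB rnorm_completion; apply: (@limit_norm_le _ _ _ _ _ L) => m Lm.
by rewrite ltW//; exact: LP.
Qed.
HB.instance Definition _ := Uniform_isComplete.Build E complete.
HB.instance Definition _ := isCStarAlgebra.Build R E norm_star.

End Completion.

Section MatrixPositivity.
Variables (R : realType) (A : starAlgType R) (n : nat).
Implicit Types x y : 'M[A]_n.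

(* An element of the C*-algebra M_n(A) is positive iff it is of the form
   y^* y. The operations are spelled out because A has no mathcomp ring
   structure. *)
Definition mxamul x y : 'M[A]_n := \matrix_(i, j) \sum_k x i k ** y k j.
Definition mxstar x : 'M[A]_n := \matrix_(i, j) star (x j i).
Definition mxpositive x := exists y, x = mxamul (mxstar y) y.

End MatrixPositivity.

Definition completely_positive (R : realType) (A B : starAlgType R)
    (phi : A -> B) :=
  forall n (x : 'M[A]_n), mxpositive x -> mxpositive (map_mx phi x).

Definition contractive (R : realType) (A B : normedModType R[i])
    (phi : A -> B) :=
  forall x, `|phi x| <= `|x|.

Definition cpc (R : realType) (A B : normedStarAlgType R)
    (phi : {linear A -> B}) :=
  completely_positive phi /\ contractive phi.

Definition lifting_property (R : realType) (A : cstarAlgType R) :=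
  forall (B : cstarAlgType R) (J : closed_ideal B)
    (phi : {linear A -> quotient J}), cpc phi ->
  exists theta : {linear A -> B}, cpc theta /\
    forall a, quotient_pi J (theta a) = phi a.

Definition star_hom (R : realType) (A B : starAlgType R)
    (f : {linear A -> B}) :=
  (forall x y, f (x ** y) = f x ** f y) /\ (forall x, f (star x) = star (f x)).

Definition star_isomorphism (R : realType) (A B : starAlgType R)
    (f : {linear A -> B}) :=
  star_hom f /\ bijective f.

Section BilinearExtension.
Variables (R : realType) (V : lmodType R[i]) (I : Type) (d : I -> V).
Variables (op : I -> I -> I) (m : V -> V -> V).
Hypothesis d_ind : forall P : V -> Prop, P 0 ->
  (forall (c : R[i]) i x, P x -> P (c *: d i + x)) -> forall x, P x.
Hypotheses (mDl : left_distributive m +%R) (mDr : right_distributive m +%R).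
Hypothesis mZl : forall (c : R[i]) x y, m (c *: x) y = c *: m x y.
Hypothesis mZr : forall (c : R[i]) x y, m x (c *: y) = c *: m x y.
Hypothesis md : forall i j, m (d i) (d j) = d (op i j).

Let m0l y : m 0 y = 0.
Proof. by apply: (addIr (m 0 y)); rewrite -mDl !add0r. Qed.
Let m0r x : m x 0 = 0.
Proof. by apply: (addIr (m x 0)); rewrite -mDr !add0r. Qed.

Lemma bilinear_assoc : associative op -> associative m.
Proof.
move=> opA x y z; elim/d_ind: x => [|c i x IHx]; first by rewrite !m0l.
rewrite !mDl IHx !mZl; congr (_ *: _ + _).
elim/d_ind: y {x IHx} => [|b j y IHy]; first by rewrite m0l !m0r m0l.
rewrite mDl !mDr mDl IHy !mZl !mZr mZl; congr (_ *: _ + _).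
elim/d_ind: z {y IHy} => [|a k z IHz]; first by rewrite !m0r.
by rewrite !mDr IHz !mZr !md opA.
Qed.

Lemma conjlinear_antimul (s : V -> V) (o : I -> I) :
  {morph s : x y / x + y} -> (forall (c : R[i]) x, s (c *: x) = c^* *: s x) ->
  (forall i, s (d i) = d (o i)) -> {morph o : i j / op i j >-> op j i} ->
  forall x y, s (m x y) = m (s y) (s x).
Proof.
move=> sD sZ sd oM x y.
have s0 : s 0 = 0 by apply: (addIr (s 0)); rewrite -sD !add0r.
elim/d_ind: x => [|c i x IHx]; first by rewrite m0l s0 m0r.
rewrite mDl !sD mDr IHx mZl !sZ mZr; congr (_ *: _ + _).
elim/d_ind: y {x IHx} => [|b j y IHy]; first by rewrite m0r s0 m0l.
by rewrite mDr !sD mDl IHy mZr !sZ mZl md !sd md oM.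
Qed.

Lemma conjlinear_involutive (s : V -> V) (o : I -> I) :
  {morph s : x y / x + y} -> (forall (c : R[i]) x, s (c *: x) = c^* *: s x) ->
  (forall i, s (d i) = d (o i)) -> involutive o -> involutive s.
Proof.
move=> sD sZ sd oK x.
have s0 : s 0 = 0 by apply: (addIr (s 0)); rewrite -sD !add0r.
elim/d_ind: x => [|c i x IHx]; first by rewrite !s0.
by rewrite !sD !sZ IHx !sd oK conjCK.
Qed.

End BilinearExtension.

(* Finitely supported functions on the discrete group G, with convolution
   (gmul) and the involution g |-> g^-1 (gstar). *)
Definition group_algebra (R : realType) (G : groupType) : Type := malg G R[i].

Section GroupAlgebra.
Variables (R : realType) (G : groupType).
Local Notation CG := (group_algebra R G).
Implicit Types (g h : G) (x y : CG).

HB.instance Definition _ := GRing.Lmodule.on CG.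

Definition gdelta g : CG := mkmalgU g 1.

Lemma group_algebraE x : x = \sum_(g <- msupp x) mcoeff g x *: gdelta g.
Proof.
rewrite {1}[x]monalgE; apply: eq_bigr => g _; apply/malgP => k.
by rewrite mcoeffZ !mcoeffU mulrnAr mulr1.
Qed.

Lemma gdelta_coeff g h : mcoeff h (gdelta g) = (g == h)%:R.
Proof. exact: mcoeffU. Qed.

Section LinearExtension.
Variables (E : lmodType R[i]) (F : G -> E).

Definition linear_extension x : E := \sum_(g <- msupp x) mcoeff g x *: F g.

Lemma linear_extensionEw (D : {fset G}) x : (msupp x `<=` D)%fset ->
  linear_extension x = \sum_(g <- D) mcoeff g x *: F g.
Proof.
move=> xD; rewrite /linear_extension (big_fset_incl _ xD)//= => g _.
by move=> /mcoeff_outdom ->; rewrite scale0r.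
Qed.

Lemma linear_extension_linear : linear linear_extension.
Proof.
move=> c x y.
have sx : (msupp x `<=` msupp x `|` msupp y)%fset := fsubsetUl _ _.
have sy : (msupp y `<=` msupp x `|` msupp y)%fset := fsubsetUr _ _.
have sxy : (msupp (c *: x + y) `<=` msupp x `|` msupp y)%fset.
  apply: fsubset_trans (msuppD_le _ _) _; apply: fsetSU; exact: msuppZ_le.
rewrite (linear_extensionEw sx) (linear_extensionEw sy) (linear_extensionEw sxy).
rewrite scaler_sumr -big_split/=; apply: eq_bigr => g _.
by rewrite mcoeffD mcoeffZ scalerDl scalerA.
Qed.
HB.instance Definition _ :=
  GRing.isLinear.Build R[i] CG E *:%R linear_extension linear_extension_linear.

Lemma linear_extension_gdelta g : linear_extension (gdelta g) = F g.
Proof.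
rewrite (@linear_extensionEw [fset g]%fset); last exact: msuppU_le.
by rewrite big_seq_fset1 gdelta_coeff eqxx scale1r.
Qed.

End LinearExtension.

Lemma group_algebra_ind (P : CG -> Prop) : P 0 ->
  (forall c g x, P x -> P (c *: gdelta g + x)) -> forall x, P x.
Proof.
move=> P0 PS x; rewrite [x]group_algebraE.
by elim: (msupp x : seq G) => [|g s IHs]; rewrite ?big_nil// big_cons; exact: PS.
Qed.

Definition gmul x y : CG :=
  linear_extension (fun g => linear_extension (fun h => gdelta (g * h)%g) y) x.

Definition gstar x : CG := \sum_(g <- msupp x) (mcoeff g x)^* *: gdelta (g^-1)%g.

Let gmul_linl y : linear (gmul^~ y).
Proof. exact: linear_extension_linear. Qed.

Let gmul_linr x : linear (gmul x).
Proof.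
move=> c y z; rewrite /gmul /linear_extension scaler_sumr -big_split/=.
apply: eq_bigr => g _; rewrite -!/(linear_extension _ _) linearP scalerDr.
by rewrite !scalerA mulrC.
Qed.

Lemma gmul_gdelta g h : gmul (gdelta g) (gdelta h) = gdelta (g * h)%g.
Proof. by rewrite /gmul !linear_extension_gdelta. Qed.

Let gmulDl : left_distributive gmul +%R.
Proof. by move=> x y z; rewrite -[x in LHS]scale1r gmul_linl scale1r. Qed.
Let gmulDr : right_distributive gmul +%R.
Proof. by move=> x y z; rewrite -[y in LHS]scale1r gmul_linr scale1r. Qed.
Let gmul0l y : gmul 0 y = 0.
Proof. by apply: (addIr (gmul 0 y)); rewrite -gmulDl !add0r. Qed.
Let gmul0r x : gmul x 0 = 0.
Proof. by apply: (addIr (gmul x 0)); rewrite -gmulDr !add0r. Qed.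
Let gmulZl (c : R[i]) x y : gmul (c *: x) y = c *: gmul x y.
Proof. by rewrite -[c *: x]addr0 gmul_linl gmul0l addr0. Qed.
Let gmulZr (c : R[i]) x y : gmul x (c *: y) = c *: gmul x y.
Proof. by rewrite -[c *: y]addr0 gmul_linr gmul0r addr0. Qed.

Let gmulA : associative gmul.
Proof.
exact: (bilinear_assoc group_algebra_ind gmulDl gmulDr gmulZl gmulZr gmul_gdelta
  (@mulgA G)).
Qed.

Let gstarEw (D : {fset G}) x : (msupp x `<=` D)%fset ->
  gstar x = \sum_(g <- D) (mcoeff g x)^* *: gdelta (g^-1)%g.
Proof.
move=> xD; rewrite /gstar (big_fset_incl _ xD)//= => g _.
by move=> /mcoeff_outdom ->; rewrite rmorph0 scale0r.
Qed.
Let gstar_conjlin (c : R[i]) x y : gstar (c *: x + y) = c^* *: gstar x + gstar y.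
Proof.
have sx : (msupp x `<=` msupp x `|` msupp y)%fset := fsubsetUl _ _.
have sy : (msupp y `<=` msupp x `|` msupp y)%fset := fsubsetUr _ _.
have sxy : (msupp (c *: x + y) `<=` msupp x `|` msupp y)%fset.
  apply: fsubset_trans (msuppD_le _ _) _; apply: fsetSU; exact: msuppZ_le.
rewrite (gstarEw sx) (gstarEw sy) (gstarEw sxy).
rewrite scaler_sumr -big_split/=; apply: eq_bigr => g _.
by rewrite mcoeffD mcoeffZ rmorphD rmorphM/= scalerDl scalerA.
Qed.

Lemma gstar_gdelta g : gstar (gdelta g) = gdelta (g^-1)%g.
Proof.
rewrite (@gstarEw [fset g]%fset); last exact: msuppU_le.
by rewrite big_seq_fset1 gdelta_coeff eqxx rmorph1 scale1r.
Qed.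

Let gstarD : {morph gstar : x y / x + y}.
Proof. by move=> x y; rewrite -[x in LHS]scale1r gstar_conjlin rmorph1 scale1r. Qed.
Let gstar0 : gstar 0 = 0.
Proof. by apply: (addIr (gstar 0)); rewrite -gstarD !add0r. Qed.
Let gstarZ (c : R[i]) x : gstar (c *: x) = c^* *: gstar x.
Proof. by rewrite -[c *: x]addr0 gstar_conjlin gstar0 addr0. Qed.
Let gstarK : involutive gstar.
Proof.
exact: (conjlinear_involutive group_algebra_ind gstarD gstarZ gstar_gdelta
  (@invgK G)).
Qed.
Let gstarM x y : gstar (gmul x y) = gmul (gstar y) (gstar x).
Proof.
exact: (conjlinear_antimul group_algebra_ind gmulDl gmulDr gmulZl gmulZr
  gmul_gdelta gstarD gstarZ gstar_gdelta (@invgM G)).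
Qed.

HB.instance Definition _ := isStarAlgebra.Build R CG gmulA gmulDl gmulDr
  gmulZl gmulZr gstarK gstarD gstarZ gstarM.

Lemma amul_gdelta g h : gdelta g ** gdelta h = gdelta (g * h)%g.
Proof. exact: gmul_gdelta. Qed.

Lemma star_gdelta g : star (gdelta g) = gdelta (g^-1)%g.
Proof. exact: gstar_gdelta. Qed.

(* The maximal C*-seminorm of C[G]: the supremum of the norms of pi x over
   all *-homomorphisms pi from C[G] to a C*-algebra. Since every C*-algebra
   embeds in some B(H), this is the supremum over all *-representations. *)
Definition full_norm x : R :=
  sup [set r | exists (B : cstarAlgType R) (pi : {linear CG -> B}),
                 star_hom pi /\ r = rnorm (pi x)].

Let rep_gdelta_le1 (B : cstarAlgType R) (pi : {linear CG -> B}) g :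
  star_hom pi -> rnorm (pi (gdelta g)) <= 1.
Proof.
move=> [piM piS].
have nS (b : B) : rnorm (star b ** b) = rnorm b ^+ 2.
  by apply: complexI; rewrite -rnormE norm_starM rnormE rmorphXn.
have g1 : rnorm (pi (gdelta g)) ^+ 2 = rnorm (pi (gdelta 1%g)).
  by rewrite -nS -piS -piM star_gdelta amul_gdelta mulVg.
have e1 : rnorm (pi (gdelta 1%g)) ^+ 2 = rnorm (pi (gdelta 1%g)).
  by rewrite -nS -piS -piM star_gdelta amul_gdelta mulVg.
have e0 := rnorm_ge0 (pi (gdelta 1%g)).
rewrite -(@ler_sqr _ _ 1) ?nnegrE ?rnorm_ge0// expr1n g1.
by move: e1 e0; set t := rnorm _ => *; nra.
Qed.

Let rep_bound (B : cstarAlgType R) (pi : {linear CG -> B}) x :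
  star_hom pi -> rnorm (pi x) <= \sum_(g <- msupp x) complex.Re `|mcoeff g x|.
Proof.
move=> piH; rewrite {1}[x]group_algebraE linear_sum.
elim: (msupp x : seq G) => [|g s IHs].
  by rewrite !big_nil -lecR -rnormE normr0.
rewrite !big_cons; apply: le_trans (rnormD _ _) _; rewrite lerD//.
by rewrite linearZ rnormZ ler_piMr ?rep_gdelta_le1// -ler0c -cabsE.
Qed.

Lemma full_norm_ge (B : cstarAlgType R) (pi : {linear CG -> B}) x :
  star_hom pi -> rnorm (pi x) <= full_norm x.
Proof.
move=> piH; apply: ub_le_sup; last by exists B, pi.
exists (\sum_(g <- msupp x) complex.Re `|mcoeff g x|).
by move=> _ [C [rho [rhoH ->]]]; exact: rep_bound.
Qed.

Lemma full_norm_le x (M : R) : 0 <= M ->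
  (forall (B : cstarAlgType R) (pi : {linear CG -> B}),
     star_hom pi -> rnorm (pi x) <= M) ->
  full_norm x <= M.
Proof.
move=> M0 xM; rewrite /full_norm; set S := [set r | _].
have [->|/set0P ne] := eqVneq S set0; first by rewrite sup0.
by apply: ge_sup => // _ [B [pi [piH ->]]]; exact: xM.
Qed.

Let full_norm_ge0 x : 0 <= full_norm x.
Proof.
rewrite /full_norm; set S := [set r | _].
have [->|/set0P[_ [B [pi [piH _]]]]] := eqVneq S set0; first by rewrite sup0.
exact: le_trans (rnorm_ge0 _) (full_norm_ge x piH).
Qed.

Let full_normD x y : full_norm (x + y) <= full_norm x + full_norm y.
Proof.
apply: full_norm_le => [|B pi piH]; first exact: addr_ge0.
by rewrite raddfD (le_trans (rnormD _ _))// lerD// full_norm_ge.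
Qed.

Let full_normZ (c : R[i]) x : full_norm (c *: x) = complex.Re `|c| * full_norm x.
Proof.
apply: (@homogeneous_le _ CG full_norm) => // {}c {}x.
have c0 : 0 <= complex.Re `|c| by rewrite -ler0c -cabsE.
apply: full_norm_le => [|B pi piH]; first exact: mulr_ge0.
by rewrite linearZ rnormZ ler_wpM2l// full_norm_ge.
Qed.

Let full_normM x y : full_norm (x ** y) <= full_norm x * full_norm y.
Proof.
apply: full_norm_le => [|B pi piH]; first exact: mulr_ge0.
rewrite piH.1; apply: (@le_trans _ _ (rnorm (pi x) * rnorm (pi y))).
  by rewrite -lecR rmorphM/= -!rnormE normaM.
by rewrite ler_pM ?rnorm_ge0 ?full_norm_ge.
Qed.

Let full_norm_star x : full_norm (star x ** x) = full_norm x ^+ 2.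
Proof.
have piE (B : cstarAlgType R) (pi : {linear CG -> B}) : star_hom pi ->
    rnorm (pi (star x ** x)) = rnorm (pi x) ^+ 2.
  move=> [piM piS]; apply: complexI.
  by rewrite piM piS -rnormE norm_starM rnormE rmorphXn.
apply/eqP; rewrite eq_le; apply/andP; split.
  apply: full_norm_le => [|B pi piH]; first exact: exprn_ge0.
  by rewrite piE// ler_sqr ?nnegrE ?rnorm_ge0// full_norm_ge.
rewrite -ler_sqrt ?exprn_ge0// sqrtr_sqr ger0_norm//.
apply: full_norm_le => [|B pi piH]; first exact: sqrtr_ge0.
rewrite -[leLHS]ger0_norm ?rnorm_ge0// -sqrtr_sqr ler_sqrt//.
by rewrite -piE// full_norm_ge.
Qed.

Definition full_seminorm : cstar_seminorm CG :=
  CStarSeminorm full_norm_ge0 full_normD full_normZ full_normM full_norm_star.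

Definition group_cstar : Type := completion full_seminorm.
HB.instance Definition _ := CStarAlgebra.on group_cstar.

Definition group_unitary g : group_cstar := completion_in full_seminorm (gdelta g).

End GroupAlgebra.

Definition extremally_disconnected (X : topologicalType) :=
  forall U : set X, open U -> open (closure U).

(* Finitely supported functions K -> Z/2, with pointwise addition as the
   (multiplicatively written) group law. *)
Definition direct_sum_Z2 (K : choiceType) : Type :=
  Algebra.to_multiplicative (malg K 'Z_2).
HB.instance Definition _ (K : choiceType) := Group.on (direct_sum_Z2 K).

Definition cube (K : choiceType) : topologicalType :=
  prod_topology (fun _ : K => bool).

Lemma cube_compact (K : choiceType) : compact [set: cube K].
Proof.
have := @tychonoff K (fun=> bool) (fun=> setT) (fun=> bool_compact).
by congr compact; apply/seteqP; split.
Qed.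

(* The character of direct_sum_Z2 K given by a point x of its dual group
   {0,1}^K; since 1 is the only nonzero value of g, it is the product of
   (-1) ^ (x k * g k) over k. *)
Definition Z2_pairing (R : realType) (K : choiceType)
    (g : direct_sum_Z2 K) (x : cube K) : R[i] :=
  \prod_(k <- msupp (g : malg K 'Z_2)) (-1) ^+ (x k).

(* Main.v *)
Require Import Defs.
From HB Require Import structures.
From mathcomp Require Import all_boot all_order all_algebra finmap.
From mathcomp Require Import complex lra ring.
From mathcomp Require Import all_classical all_reals.
From mathcomp Require Import interval_inference topology normedtype borel_hierarchy.
From mathcomp Require Import sequences function_spaces realfun numfun.
From mathcomp Require Import -(notations) monalg.
From mathcomp Require spectral sesquilinear.
Import numFieldNormedType.Exports.
Set Implicit Arguments. Unset Strict Implicit. Unset Printing Implicit Defensive.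
Import Order.TTheory GRing.Theory Num.Theory.
Local Open Scope classical_set_scope.
Local Open Scope complex_scope.
Local Open Scope ring_scope.

(** Why C(X) fails the lifting property. The idea is to test liftings on a
    universal lifting problem with values in M = M_2(C), in which a lifting of
    a depends on the coordinates of a point t only, up to epsilon, through
    finitely many of them.

    For a C*-algebra A, let T be the set of all contractions t : A -> M, that
    is, functions with |t a| <= |a|, not necessarily linear. Let B be the
    C*-algebra of bounded functions f : T -> M such that, up to epsilon, f t is
    determined by the approximate values of t at finitely many elements of A
    ([tamefun]). The evaluations t |-> t a belong to B, and modulo the ideal of
    the functions that vanish at all *-homomorphisms t they depend on a in a
    multiplicative, hence cpc, way. If A has the lifting property, there is
    then a completely positive theta : A -> B with theta a t = t a for each
    *-homomorphism t ([lifting_extension]); at the other points t, theta a t is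
    constrained only by positivity and by continuity in t.

    For A = C(X), where X is a nonempty compact Hausdorff space without G_delta
    points, this is contradictory ([compact_without_Gdelta_no_lifting]). As X
    has no isolated points it is infinite, so some x is an
    accumulation point of a sequence of distinct points z_j. Choose a countable
    S in C(X) that contains 1 and functions separating the z_j pairwise, and is
    closed in the sense that theta f, for f in S, depends only on the coordinates in
    S. As x is not a G_delta point, some x' != x has f x = f x' for all f in S.
    Let rho be f |-> W diag(f x, f x') W^*, with W a rotation, and let t agree
    with f |-> diag(f z_j, f z_k) on S and with rho outside S. As f x = f x' on
    S, t is close to rho as soon as z_j and z_k are close to x. On the one
    hand, for f in S, theta f t = diag(f z_j, f z_k); applying this to an f with
    f z_j = 1 and f z_k = 0, positivity forces theta h t to be diagonal
    for every h with 0 <= h <= 1. On the other hand, if h x = 1 and h x' = 0,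
    theta h t is close to theta h rho = rho h, which is not diagonal.

    For 2^K, the *-homomorphism from the group algebra of the direct sum of
    copies of Z/2 to C(2^K) that maps each group element to its character is
    isometric for the full norm ([full_norm_gelfand]) and has dense range
    ([gelfand_dense]); hence it extends to an isomorphism from the completion
    onto C(2^K). When K is uncountable 2^K has no G_delta points, and the
    failure of the lifting property goes back along the isomorphism. *)

(** * Norm, zero and limits in C*-algebras *)

Section StarAlgebraZero.
Variables (R : realType) (V : starAlgType R).
Implicit Types x : V.

Lemma amul0x x : 0 ** x = 0.
Proof. by have := amulBl 0 0 x; rewrite !subrr. Qed.

Lemma amulx0 x : x ** 0 = 0.
Proof. by have := amulBr x 0 0; rewrite !subrr. Qed.

Lemma star0 : star (0 : V) = 0.
Proof. by have := starB (0 : V) 0; rewrite !subrr. Qed.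

End StarAlgebraZero.

Lemma rnorm0 (R : realType) (V : normedModType R[i]) : rnorm (0 : V) = 0.
Proof. by rewrite /rnorm normr0. Qed.

Section RnormTheory.
Variables (R : realType) (B : cstarAlgType R).
Implicit Types x y : B.

Lemma rnormM x y : rnorm (x ** y) <= rnorm x * rnorm y.
Proof. by rewrite -lecR rmorphM/= -!rnormE normaM. Qed.

Lemma rnorm_starM x : rnorm (star x ** x) = rnorm x ^+ 2.
Proof. by apply: complexI; rewrite -rnormE norm_starM rnormE rmorphXn. Qed.

Lemma rnormS x : rnorm (star x) = rnorm x.
Proof.
have le y : rnorm y <= rnorm (star y).
  have := rnormM (star y) y; rewrite rnorm_starM expr2.
  have := rnorm_ge0 y; rewrite le_eqVlt => /predU1P[<- _|y0].
    exact: rnorm_ge0.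
  by rewrite ler_pM2r.
by apply/eqP; rewrite eq_le le -{2}(starK x) le.
Qed.

End RnormTheory.

Section SequenceLimits.
Variables (R : realType) (B : cstarAlgType R).
Implicit Types (u v : nat -> B) (x y : B).
Local Notation cvgs := (seq_cvg (@rnorm R B)).

Lemma seq_cvgP u x : cvgs u x <-> u @ \oo --> x.
Proof.
split=> [ux|ux e e0].
  apply/cvgrPdist_lt => e /gt0_complex[e0 ->]; have [N NP] := ux _ e0.
  by exists N => // n /= /NP; rewrite lt_rnorm rnormB.
have /cvgrPdist_lt/(_ e%:C) := ux; rewrite ltcR => /(_ e0)[N _ NP].
by exists N => n /NP; rewrite lt_rnorm rnormB.
Qed.

Lemma seq_cvg_unique u x y : cvgs u x -> cvgs u y -> x = y.
Proof. by move=> /seq_cvgP ux /seq_cvgP uy; exact: (cvg_unique _ ux uy). Qed.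

Lemma seq_cvg_linear (c : R[i]) u v x y : cvgs u x -> cvgs v y ->
  cvgs (fun n => c *: u n + v n) (c *: x + y).
Proof.
move=> /seq_cvgP ux /seq_cvgP vy; apply/seq_cvgP.
by apply: cvgD => //; exact: cvgZr.
Qed.

Lemma seq_cvg_star u x : cvgs u x -> cvgs (fun n => star (u n)) (star x).
Proof.
by move=> ux e /ux[N NP]; exists N => n /NP; rewrite -starB rnormS.
Qed.

Lemma seq_cvgM u v x y (K : R) : 0 < K -> (forall n, rnorm (v n) <= K) ->
  cvgs u x -> cvgs v y -> cvgs (fun n => u n ** v n) (x ** y).
Proof.
move=> K0 vK ux vy e e0; have e20 := divr_gt0 e0 (ltr0n R 2).
have x1 : 0 < rnorm x + 1 by rewrite ltr_wpDl// rnorm_ge0.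
have [N NP] := ux _ (divr_gt0 e20 K0); have [m mP] := vy _ (divr_gt0 e20 x1).
exists (maxn N m) => n; rewrite geq_max => /andP[/NP un /mP vn].
rewrite -(subrKA (x ** v n)) -amulBl -amulBr (le_lt_trans (rnormD _ _))//.
rewrite (splitr e) ltrD// (le_lt_trans (rnormM _ _))//.
  apply: (@le_lt_trans _ _ (rnorm (u n - x) * K)).
    by rewrite ler_wpM2l ?rnorm_ge0.
  by rewrite -ltr_pdivlMr.
apply: (@le_lt_trans _ _ ((rnorm x + 1) * rnorm (v n - y))).
  by rewrite ler_wpM2r ?rnorm_ge0// lerDl.
by rewrite mulrC -ltr_pdivlMr.
Qed.

Lemma seq_cvg_rnorm u x : cvgs u x -> (fun n => rnorm (u n)) @ \oo --> rnorm x.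
Proof.
have le y z : rnorm y - rnorm z <= rnorm (y - z).
  by rewrite lerBlDr -{1}(subrK z y) rnormD.
move=> ux; apply/cvgrPdist_lt => e /ux[N NP]; exists N => // n /= /NP.
by apply: le_lt_trans; rewrite ler_norml lerNl opprB le rnormB le.
Qed.

Lemma seq_cauchy_cvg u : seq_cauchy (@rnorm R B) u -> exists x, cvgs u x.
Proof.
move=> uc; suff /cauchy_cvgP/cvg_ex[x /seq_cvgP ux] : cauchy (nbhs (u @ \oo)).
  by exists x.
apply/cauchy_exP => e /gt0_complex[e0 eE]; have [N NP] := uc _ e0.
exists (u N); exists N => // n /= Nn.
by rewrite -ball_normE /ball_/= eE lt_rnorm; exact: NP.
Qed.

End SequenceLimits.

Section ComplexModulus.
Variable R : realType.

Lemma cabs_ge0 (c : R[i]) : 0 <= complex.Re `|c|.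
Proof. by rewrite -ler0c -cabsE. Qed.

Lemma cabs_real (r : R) : 0 <= r -> complex.Re `|r%:C| = r.
Proof. by move=> r0; rewrite ger0_norm ?ler0c. Qed.

Lemma cabs_realN (r : R) : complex.Re `|r%:C| = `|r|.
Proof. by rewrite normc_def /= expr0n addr0 sqrtr_sqr. Qed.

Lemma cabs_sum (I : Type) (s : seq I) (F : I -> R[i]) :
  complex.Re `|\sum_(i <- s) F i| <= \sum_(i <- s) complex.Re `|F i|.
Proof.
elim: s => [|i s IHs]; first by rewrite !big_nil normr0.
by rewrite !big_cons; apply: le_trans (cabsD _ _) _; rewrite lerD2l.
Qed.

End ComplexModulus.

(** * Completely positive maps *)

Section CompletelyPositive.
Variable R : realType.

Lemma completely_positive_comp (B C D : starAlgType R) (f : C -> D) (g : B -> C) :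
  completely_positive f -> completely_positive g -> completely_positive (f \o g).
Proof. by move=> fP gP n x /gP/fP; rewrite -map_mx_comp. Qed.

Lemma star_hom_completely_positive (C D : starAlgType R) (pi : {linear C -> D}) :
  star_hom pi -> completely_positive pi.
Proof.
move=> [piM piS] n _ [y ->]; exists (map_mx pi y).
apply/matrixP => i j; rewrite !mxE raddf_sum; apply: eq_bigr => k _.
by rewrite !mxE/= piM piS.
Qed.

Lemma completely_positive_pos (A B : starAlgType R) (theta : A -> B) a :
  completely_positive theta -> exists b, theta (star a ** a) = star b ** b.
Proof.
move=> /(_ 1 (\matrix_(i, j) (star a ** a)))[|y /matrixP/(_ 0 0)].
  exists (\matrix_(i, j) a).
  by apply/matrixP => i j; rewrite !mxE big_ord1 !mxE.
by rewrite !mxE big_ord1 !mxE => ->; exists (y 0 0).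
Qed.

End CompletelyPositive.

(** * The C*-algebra of n x n matrices *)

(** An alias, because matrices over R[i] already carry the entrywise maximum
    norm, which is not a C*-norm. *)
Definition matalg (R : realType) (n : nat) : Type := 'M[R[i]]_n.

Section MatrixAlgebra.
Variables (R : realType) (n : nat).
Local Notation M := (matalg R n).
Implicit Types (a b : M) (u v : 'rV[R[i]]_n).

HB.instance Definition _ := GRing.Lmodule.on M.

Definition mat_mul a b : M := a *m b.
Definition mat_star a : M := \matrix_(i, j) (a j i)^*.

Let mat_mulA : associative mat_mul. Proof. exact: mulmxA. Qed.
Let mat_mulDl : left_distributive mat_mul +%R. Proof. exact: mulmxDl. Qed.
Let mat_mulDr : right_distributive mat_mul +%R. Proof. exact: mulmxDr. Qed.
Let mat_mulZl (c : R[i]) a b : mat_mul (c *: a) b = c *: mat_mul a b.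
Proof. by rewrite /mat_mul -scalemxAl. Qed.
Let mat_mulZr (c : R[i]) a b : mat_mul a (c *: b) = c *: mat_mul a b.
Proof. by rewrite /mat_mul -scalemxAr. Qed.
Let mat_starK : involutive mat_star.
Proof. by move=> a; apply/matrixP => i j; rewrite !mxE conjCK. Qed.
Let mat_starD : {morph mat_star : a b / a + b}.
Proof. by move=> a b; apply/matrixP => i j; rewrite !mxE rmorphD. Qed.
Let mat_starZ (c : R[i]) a : mat_star (c *: a) = c^* *: mat_star a.
Proof. by apply/matrixP => i j; rewrite !mxE rmorphM. Qed.
Let mat_starM a b : mat_star (mat_mul a b) = mat_mul (mat_star b) (mat_star a).
Proof.
apply/matrixP => i j; rewrite !mxE rmorph_sum; apply: eq_bigr => k _.
by rewrite !mxE rmorphM mulrC.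
Qed.
HB.instance Definition _ := isStarAlgebra.Build R M mat_mulA mat_mulDl mat_mulDr
  mat_mulZl mat_mulZr mat_starK mat_starD mat_starZ mat_starM.

Definition dot u v : R[i] := \sum_i u 0 i * (v 0 i)^*.
Definition vnorm u : R := Num.sqrt (complex.Re (dot u u)).

Lemma dotC u v : dot v u = (dot u v)^*.
Proof.
rewrite /dot rmorph_sum; apply: eq_bigr => i _.
by rewrite rmorphM/= conjCK mulrC.
Qed.

Lemma dotZ (c d : R[i]) u v : dot (c *: u) (d *: v) = c * d^* * dot u v.
Proof.
rewrite /dot mulr_sumr; apply: eq_bigr => i _.
by rewrite !mxE rmorphM mulrACA.
Qed.

(** Matrices act on row vectors from the right; the star is the adjoint for
    this action. *)
Lemma dot_star u v a : dot (u *m a) v = dot u (v *m mat_star a).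
Proof.
rewrite /dot; under eq_bigr => i _ do rewrite !mxE mulr_suml.
rewrite exchange_big/=; apply: eq_bigr => i _.
rewrite !mxE rmorph_sum mulr_sumr; apply: eq_bigr => j _.
by rewrite rmorphM/= [mat_star a _ _]mxE conjCK -mulrA [_ * _^*]mulrC.
Qed.

Lemma dot_ge0 u : 0 <= dot u u.
Proof. by apply: sumr_ge0 => i _; exact: mulcJ_ge0. Qed.

Lemma dotuuE u : dot u u = (complex.Re (dot u u))%:C.
Proof. by rewrite RRe_real// ger0_real// dot_ge0. Qed.

Lemma Re_dot_ge0 u : 0 <= complex.Re (dot u u).
Proof. by rewrite -ler0c -dotuuE dot_ge0. Qed.

Lemma vnorm_sq u : vnorm u ^+ 2 = complex.Re (dot u u).
Proof. by rewrite sqr_sqrtr// Re_dot_ge0. Qed.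

Lemma vnorm_ge0 u : 0 <= vnorm u. Proof. exact: sqrtr_ge0. Qed.

Lemma dot_CauchySchwarz u v : complex.Re `|dot u v| <= vnorm u * vnorm v.
Proof.
have dotE w z : spectral.dotmx w z = dot w z.
  rewrite spectral.dotmxE mxE; apply: eq_bigr => i _; by rewrite !mxE.
rewrite -(@ler_pXn2r _ 2)// ?nnegrE ?mulr_ge0 ?vnorm_ge0//; last first.
  by rewrite -ler0c -cabsE.
have : `|dot u v| ^+ 2 <= dot u u * dot v v.
  rewrite -!dotE.
  by have [] := @sesquilinear.CauchySchwarz _ _ (@spectral.dotmx R[i] n) u v.
by rewrite (dotuuE u) (dotuuE v) cabsE -rmorphXn -rmorphM/= lecR exprMn !vnorm_sq.
Qed.

End MatrixAlgebra.

Section OperatorNorm.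
Variables (R : realType) (n : nat).
Local Notation M := (matalg R n).
Implicit Types (a b : M) (u v : 'rV[R[i]]_n).

Lemma vnorm_delta i : vnorm (delta_mx 0 i : 'rV[R[i]]_n) = 1.
Proof.
rewrite /vnorm /dot (bigD1 i)//= !mxE !eqxx/= conjC1 mulr1 big1 => [|j ji].
  by rewrite addr0 sqrtr1.
by rewrite !mxE (negPf ji) mul0r.
Qed.

Lemma dot_deltar u i : dot u (delta_mx 0 i) = u 0 i.
Proof.
rewrite /dot (bigD1 i)//= !mxE !eqxx/= conjC1 mulr1 big1 => [|j ji].
  by rewrite addr0.
by rewrite !mxE (negPf ji) conjC0 mulr0.
Qed.

Lemma cabs_le_vnorm u i : complex.Re `|u 0 i| <= vnorm u.
Proof.
rewrite -(dot_deltar u i); apply: le_trans (dot_CauchySchwarz _ _) _.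
by rewrite vnorm_delta mulr1.
Qed.

Lemma vnorm0_eq0 u : vnorm u = 0 -> u = 0.
Proof.
move=> u0; apply/rowP => i; rewrite mxE; apply/eqP; rewrite -normr_eq0 cabsE.
have := cabs_le_vnorm u i; rewrite u0 => ui.
by have -> : complex.Re `|u 0 i| = 0 by apply/eqP; rewrite eq_le ui cabs_ge0.
Qed.

Lemma vnormZ (r : R) u : 0 <= r -> vnorm (r%:C *: u) = r * vnorm u.
Proof.
move=> r0; apply/eqP; rewrite -(@eqrXn2 _ 2)// ?mulr_ge0 ?vnorm_ge0//.
rewrite exprMn !vnorm_sq dotZ (dotuuE u).
by rewrite [(r%:C)^*%R]conjc_real -!rmorphM/= expr2.
Qed.

Definition opnorm_set a : set R :=
  [set r | exists u v, [/\ vnorm u <= 1, vnorm v <= 1 &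
                          r = complex.Re `|dot (u *m a) v|]].

(** The operator norm, in its bilinear form: the triangle inequality and the
    invariance under the star are then immediate. *)
Definition opnorm a : R := sup (opnorm_set a).

Let opnorm_set_ub a r : opnorm_set a r ->
  r <= \sum_i \sum_j complex.Re `|a j i|.
Proof.
move=> [u [v [u1 v1 ->]]]; apply: le_trans (cabs_sum _ _) _.
apply: ler_sum => i _; rewrite cabsM cabsJ.
rewrite -[leRHS]mulr1; apply: ler_pM; rewrite ?cabs_ge0//; last first.
  exact: le_trans (cabs_le_vnorm _ _) v1.
rewrite mxE; apply: le_trans (cabs_sum _ _) _; apply: ler_sum => j _.
rewrite cabsM -[leRHS]mul1r ler_pM ?cabs_ge0//.
exact: le_trans (cabs_le_vnorm _ _) u1.
Qed.

Let vnorm0 : vnorm (0 : 'rV[R[i]]_n) = 0.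
Proof. by rewrite /vnorm /dot big1 ?sqrtr0// => i _; rewrite mxE mul0r. Qed.

Let opnorm_set_ne a : opnorm_set a !=set0.
Proof. by exists (complex.Re `|dot (0 *m a) 0|), 0, 0; rewrite vnorm0. Qed.

Lemma opnorm_le a (m : R) :
  (forall u v, vnorm u <= 1 -> vnorm v <= 1 -> complex.Re `|dot (u *m a) v| <= m) ->
  opnorm a <= m.
Proof.
by move=> am; apply: ge_sup (opnorm_set_ne a) _ => _ [u [v [u1 v1 ->]]]; exact: am.
Qed.

Lemma opnorm_le_sum a : opnorm a <= \sum_i \sum_j complex.Re `|a j i|.
Proof. by apply: ge_sup (opnorm_set_ne a) _ => r; exact: opnorm_set_ub. Qed.

Lemma opnorm_ge_unit a u v : vnorm u <= 1 -> vnorm v <= 1 ->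
  complex.Re `|dot (u *m a) v| <= opnorm a.
Proof.
move=> u1 v1; apply: ub_le_sup; last by exists u, v.
by exists (\sum_i \sum_j complex.Re `|a j i|) => r; exact: opnorm_set_ub.
Qed.

Lemma opnorm_ge0 a : 0 <= opnorm a.
Proof.
apply: le_trans (@opnorm_ge_unit a 0 0 _ _); rewrite ?vnorm0//.
exact: cabs_ge0.
Qed.

Lemma opnorm_dot a u v :
  complex.Re `|dot (u *m a) v| <= opnorm a * vnorm u * vnorm v.
Proof.
have dot0l w : dot 0 w = 0 by rewrite /dot big1// => i _; rewrite mxE mul0r.
have dot0r w : dot w 0 = 0.
  by rewrite /dot big1// => i _; rewrite mxE conjC0 mulr0.
have [/vnorm0_eq0->|u0] := eqVneq (vnorm u) 0.
  by rewrite mul0mx dot0l normr0 vnorm0 mulr0 mul0r.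
have [/vnorm0_eq0->|v0] := eqVneq (vnorm v) 0.
  by rewrite dot0r normr0 vnorm0 mulr0.
have un : 0 < vnorm u by rewrite lt_def u0 vnorm_ge0.
have vn : 0 < vnorm v by rewrite lt_def v0 vnorm_ge0.
have := @opnorm_ge_unit a ((vnorm u)^-1%:C *: u) ((vnorm v)^-1%:C *: v).
rewrite !vnormZ ?invr_ge0 ?vnorm_ge0// !mulVf// => /(_ (lexx _) (lexx _)).
rewrite -scalemxAl dotZ [_^*%R]conjc_real.
rewrite -[_%:C * _%:C](rmorphM (real_complex R)) cabsM.
rewrite cabs_real ?mulr_ge0 ?invr_ge0 ?vnorm_ge0//.
by rewrite -invfM ler_pdivrMl ?mulr_gt0// mulrC mulrA.
Qed.

Lemma opnorm_ge_entry a i j : complex.Re `|a i j| <= opnorm a.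
Proof.
rewrite -[X in `|X|](_ : dot (delta_mx 0 i *m a) (delta_mx 0 j) = _).
  by apply: opnorm_ge_unit; rewrite vnorm_delta.
by rewrite dot_deltar -rowE mxE.
Qed.

Lemma vnorm_mul a u : vnorm (u *m a) <= opnorm a * vnorm u.
Proof.
have := opnorm_dot a u (u *m a).
have -> : complex.Re `|dot (u *m a) (u *m a)| = vnorm (u *m a) ^+ 2.
  by rewrite vnorm_sq ger0_norm ?dot_ge0.
have [->|u0] := eqVneq (vnorm (u *m a)) 0.
  by move=> _; rewrite mulr_ge0 ?vnorm_ge0 ?opnorm_ge0.
by rewrite expr2 ler_pM2r// lt_def u0 vnorm_ge0.
Qed.

Lemma opnormD a b : opnorm (a + b) <= opnorm a + opnorm b.
Proof.
apply: opnorm_le => u v u1 v1; rewrite mulmxDr.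
have -> : dot (u *m a + u *m b) v = dot (u *m a) v + dot (u *m b) v.
  by rewrite /dot -big_split; apply: eq_bigr => i _; rewrite [_ 0 i]mxE mulrDl.
by apply: le_trans (cabsD _ _) _; rewrite lerD// opnorm_ge_unit.
Qed.

Lemma opnormZ (c : R[i]) a : opnorm (c *: a) = complex.Re `|c| * opnorm a.
Proof.
apply: (@homogeneous_le _ M opnorm); first exact: opnorm_ge0.
move=> {}c {}a; apply: opnorm_le => u v u1 v1.
rewrite -scalemxAr -[v in dot _ v]scale1r dotZ conjC1 mulr1 cabsM.
by rewrite ler_wpM2l ?cabs_ge0// opnorm_ge_unit.
Qed.

Lemma opnorm0_eq0 a : opnorm a = 0 -> a = 0.
Proof.
move=> a0; apply/matrixP => i j; rewrite mxE; apply/eqP.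
rewrite -normr_eq0 cabsE.
have := opnorm_ge_entry a i j; rewrite a0 => aij.
by have -> : complex.Re `|a i j| = 0 by apply/eqP; rewrite eq_le aij cabs_ge0.
Qed.

Lemma opnormM a b : opnorm (a ** b) <= opnorm a * opnorm b.
Proof.
apply: opnorm_le => u v u1 v1; rewrite [a ** b]/(a *m b) mulmxA.
apply: le_trans (opnorm_dot _ _ _) _; rewrite mulrAC mulrC.
apply: (@le_trans _ _ ((opnorm a * 1) * (opnorm b * 1))); last by rewrite !mulr1.
rewrite ler_pM ?mulr_ge0 ?opnorm_ge0 ?vnorm_ge0//; last first.
  by rewrite ler_wpM2l ?opnorm_ge0.
apply: le_trans (vnorm_mul _ _) _.
by rewrite ler_wpM2l ?opnorm_ge0.
Qed.

(** Only opnorm a ^+ 2 <= opnorm (star a ** a) needs an argument: |u a^*|^2 is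
    the inner product of u and u a^* a, and |<u a^*, v>| <= |u a^*| |v|. *)
Lemma opnorm_star_mul a : opnorm (star a ** a) = opnorm a ^+ 2.
Proof.
have opS b : opnorm (star b) <= opnorm b.
  apply: opnorm_le => u v u1 v1; rewrite dot_star [mat_star _]starK.
  by rewrite dotC cabsJ opnorm_ge_unit.
apply/eqP; rewrite eq_le; apply/andP; split.
  apply: le_trans (opnormM _ _) _.
  by rewrite expr2 ler_wpM2r ?opnorm_ge0.
have aS : opnorm a <= Num.sqrt (opnorm (star a ** a)).
  rewrite -{1}(starK a); apply: le_trans (opS _) _.
  apply: opnorm_le => u v u1 v1; apply: le_trans (dot_CauchySchwarz _ _) _.
  rewrite -[leRHS]mulr1 ler_pM ?vnorm_ge0// -[leLHS]ger0_norm ?vnorm_ge0//.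
  rewrite -sqrtr_sqr ler_sqrt ?opnorm_ge0// vnorm_sq dot_star.
  rewrite [mat_star _]starK -mulmxA.
  apply: le_trans (@opnorm_ge_unit (star a ** a) u u u1 u1).
  by rewrite [in leRHS]dotC cabsJ; apply: le_trans (cabs_ge_Re _); exact: ler_norm.
rewrite -[leRHS]sqr_sqrtr ?opnorm_ge0//.
by rewrite ler_sqr ?nnegrE ?opnorm_ge0 ?sqrtr_ge0.
Qed.

End OperatorNorm.

Section MatrixCStar.
Variables (R : realType) (n : nat).
Local Notation M := (matalg R n).
Implicit Types a b : M.

Let opnormCD a b : (opnorm (a + b))%:C <= (opnorm a)%:C + (opnorm b)%:C.
Proof. by rewrite -rmorphD/= lecR opnormD. Qed.

Let opnormCZ (c : R[i]) a : (opnorm (c *: a))%:C = `|c| * (opnorm a)%:C.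
Proof. by rewrite opnormZ rmorphM/= -cabsE. Qed.

Let opnormC0_eq0 a : (opnorm a)%:C = 0 -> a = 0.
Proof. by move=> /complexI; exact: opnorm0_eq0. Qed.

HB.instance Definition _ :=
  Lmodule_isNormed.Build R[i] M opnormCD opnormCZ opnormC0_eq0.

Lemma rnorm_mat a : rnorm a = opnorm a.
Proof. by []. Qed.

Let opnormCM a b : `|a ** b| <= `|a| * `|b|.
Proof. by rewrite !rnormE -rmorphM/= lecR; exact: opnormM. Qed.
HB.instance Definition _ := isNormedStarAlgebra.Build R M opnormCM.

Let mat_complete (F : set_system M) : ProperFilter F -> cauchy F -> cvg F.
Proof.
apply: seq_complete => u uc.
have /choice[l ul] : forall p : 'I_n * 'I_n, exists l : R[i], forall e : R, 0 < e ->
    exists N, forall k, (N <= k)%N -> complex.Re `|u k p.1 p.2 - l| < e.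
  move=> [i j]; apply: C_seq_complete => e /uc[N NP]; exists N => k m Nk Nm.
  apply: le_lt_trans (NP _ _ Nk Nm).
  have -> : u k i j - u m i j = (u k - u m) i j by rewrite !mxE.
  exact: opnorm_ge_entry.
exists (\matrix_(i, j) l (i, j)) => e e0.
have d0 : 0 < e / (n * n).+1%:R by rewrite divr_gt0// ltr0n.
have /choice[N NP] := fun p => ul p _ d0.
exists (\max_p N p)%N => k Nk; rewrite rnorm_mat.
apply: le_lt_trans (opnorm_le_sum _) _.
apply: (@le_lt_trans _ _ (\sum_(i < n) \sum_(j < n) e / (n * n).+1%:R)).
  apply: ler_sum => i _; apply: ler_sum => j _.
  rewrite !mxE ltW//; apply: (NP (j, i)); apply: leq_trans Nk.
  exact: (leq_bigmax (j, i)).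
rewrite !sumr_const !card_ord -mulrnA -[_ / _ *+ _]mulr_natr mulrAC.
by rewrite ltr_pdivrMr ?ltr0n// ltr_pM2l// ltr_nat.
Qed.
HB.instance Definition _ := Uniform_isComplete.Build M mat_complete.

Let opnormC_star a : `|star a ** a| = `|a| ^+ 2.
Proof.
by rewrite !rnormE -rmorphXn/=; congr (_%:C); exact: opnorm_star_mul.
Qed.
HB.instance Definition _ := isCStarAlgebra.Build R M opnormC_star.

End MatrixCStar.

(** * The universal lifting problem *)

Section TameFunctions.
Variables (R : realType) (A M : cstarAlgType R).

(** The points on which the functions of the universal algebra are defined.
    Linearity is not required, so that two contractions can be
    recombined coordinate by coordinate; the bound by the norm of the argument
    makes evaluations contractive. *)
Record contraction := Contraction {
  contraction_fun :> A -> M;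
  contractionP : forall a, rnorm (contraction_fun a) <= rnorm a }.
Local Notation T := contraction.
Implicit Types (s t : T) (f g : T -> M).

Definition bounded_fun f := exists K : R, forall t, rnorm (f t) <= K.

(** Uniform continuity for the product uniformity of A -> M. *)
Definition finitely_determined f := forall e : R, 0 < e ->
  exists (F : seq A) (d : R), 0 < d /\
    forall s t, (forall a, a \in F -> rnorm (s a - t a) < d) ->
      rnorm (f s - f t) <= e.

Definition tame_pred : {pred T -> M} :=
  fun f => `[< bounded_fun f /\ finitely_determined f >].

Let tame_submod : submod_closed tame_pred.
Proof.
split=> [|c f g /asboolP[[Kf fK] fF] /asboolP[[Kg gK] gF]]; apply/asboolP.
  split; first by exists 0 => t; rewrite rnorm0.
  by move=> e e0; exists [::], 1; split=> // s t _; rewrite subrr rnorm0 ltW.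
split.
  exists (complex.Re `|c| * Kf + Kg) => t.
  by rewrite (le_trans (rnormD _ _))// lerD// rnormZ ler_wpM2l ?cabs_ge0.
move=> e e0; have c1 : 0 < complex.Re `|c| + 1 by rewrite ltr_wpDl// cabs_ge0.
have [F [d [d0 Fd]]] := fF _ (divr_gt0 (divr_gt0 e0 (ltr0n R 2)) c1).
have [G [d' [d'0 Gd]]] := gF _ (divr_gt0 e0 (ltr0n R 2)).
exists (F ++ G), (Num.min d d'); split=> [|s t st]; first by rewrite lt_min d0.
have -> : (c *: f + g) s - (c *: f + g) t = c *: (f s - f t) + (g s - g t).
  by rewrite [_ s]/= [_ t]/= opprD addrACA scalerBr.
rewrite (le_trans (rnormD _ _))// (splitr e) lerD//.
  rewrite rnormZ (@le_trans _ _ ((complex.Re `|c| + 1) * rnorm (f s - f t)))//.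
    by rewrite ler_wpM2r ?rnorm_ge0// lerDl.
  rewrite mulrC -ler_pdivlMr//; apply: Fd => a aF.
  by have := st a; rewrite mem_cat aF lt_min => /(_ isT)/andP[].
apply: Gd => a aG.
by have := st a; rewrite mem_cat aG orbT lt_min => /(_ isT)/andP[].
Qed.
HB.instance Definition _ :=
  GRing.isSubmodClosed.Build R[i] (T -> M) tame_pred tame_submod.

Record tamefun := TameFun { tame_val :> T -> M; _ : tame_val \in tame_pred }.

HB.instance Definition _ := [isSub of tamefun for tame_val].
HB.instance Definition _ := [Choice of tamefun by <:].
HB.instance Definition _ := [SubChoice_isSubLmodule of tamefun by <:].

Implicit Types x y : tamefun.

Lemma tamefun_bounded x : bounded_fun x.
Proof. by case: x => f /= /asboolP[]. Qed.

Lemma tamefun_determined x : finitely_determined x.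
Proof. by case: x => f /= /asboolP[]. Qed.

Lemma tamefunP x y : (forall t, x t = y t) -> x = y.
Proof. by move=> xy; apply/val_inj/funext. Qed.

Lemma tamefunD x y t : (x + y) t = x t + y t. Proof. by []. Qed.
Lemma tamefunB x y t : (x - y) t = x t - y t. Proof. by []. Qed.
Lemma tamefunZ (c : R[i]) x t : (c *: x) t = c *: x t. Proof. by []. Qed.

Definition tamenorm x : R := sup [set rnorm (x t) | t in [set: T]].

Let zero_contraction : T.
Proof. by exists (fun=> 0) => a; rewrite rnorm0 rnorm_ge0. Defined.

Lemma le_tamenorm x t : rnorm (x t) <= tamenorm x.
Proof.
apply: ub_le_sup; last by exists t.
by have [K xK] := tamefun_bounded x; exists K => _ [{}t _ <-].
Qed.

Lemma tamenorm_le x (K : R) : (forall t, rnorm (x t) <= K) -> tamenorm x <= K.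
Proof.
move=> xK; apply: ge_sup; last by move=> _ [t _ <-].
by exists (rnorm (x zero_contraction)), zero_contraction.
Qed.

Lemma tamenorm_ge0 x : 0 <= tamenorm x.
Proof. exact: le_trans (rnorm_ge0 _) (le_tamenorm x zero_contraction). Qed.

Let tamenormD x y : (tamenorm (x + y))%:C <= (tamenorm x)%:C + (tamenorm y)%:C.
Proof.
rewrite -rmorphD/= lecR; apply: tamenorm_le => t.
by rewrite (le_trans (rnormD _ _))// lerD// le_tamenorm.
Qed.

Let tamenormZ (c : R[i]) x : (tamenorm (c *: x))%:C = `|c| * (tamenorm x)%:C.
Proof.
rewrite [X in _ = X * _]cabsE -rmorphM; congr (_%:C).
apply: (@homogeneous_le _ tamefun tamenorm); first exact: tamenorm_ge0.
move=> {}c {}x; apply: tamenorm_le => t.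
by rewrite tamefunZ rnormZ ler_wpM2l ?cabs_ge0// le_tamenorm.
Qed.

Let tamenorm0_eq0 x : (tamenorm x)%:C = 0 -> x = 0.
Proof.
move=> /complexI x0; apply: tamefunP => t; apply: rnorm0_eq0.
by apply/eqP; rewrite eq_le rnorm_ge0 andbT -x0 le_tamenorm.
Qed.

HB.instance Definition _ :=
  Lmodule_isNormed.Build R[i] tamefun tamenormD tamenormZ tamenorm0_eq0.

Lemma rnorm_tamefun x : rnorm x = tamenorm x. Proof. by []. Qed.

Let mul_subproof x y : (fun t => x t ** y t) \in tame_pred.
Proof.
have [Kx xK] := tamefun_bounded x; have [Ky yK] := tamefun_bounded y.
have K0 : 0 < `|Kx| + `|Ky| + 1 by rewrite ltr_wpDl// addr_ge0.
have {}xK t : rnorm (x t) <= `|Kx| + `|Ky| + 1.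
  apply: le_trans (xK t) _; rewrite -addrA; apply: le_trans (ler_norm _) _.
  by rewrite lerDl addr_ge0.
have {}yK t : rnorm (y t) <= `|Kx| + `|Ky| + 1.
  apply: le_trans (yK t) _; rewrite addrAC; apply: le_trans (ler_norm _) _.
  by rewrite lerDr addr_ge0.
move: xK yK; set K := _ + 1 => xK yK.
apply/asboolP; split.
  exists (K * K) => t; apply: le_trans (rnormM _ _) _.
  by rewrite ler_pM ?rnorm_ge0.
move=> e e0; have e1 := divr_gt0 (divr_gt0 e0 (ltr0n R 2)) K0.
have [F [d [d0 Fd]]] := tamefun_determined x e1.
have [G [d' [d'0 Gd]]] := tamefun_determined y e1.
exists (F ++ G), (Num.min d d'); split=> [|s t st]; first by rewrite lt_min d0.
rewrite -(subrKA (x s ** y t)) -amulBl -amulBr (le_trans (rnormD _ _))//.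
rewrite (splitr e) lerD// (le_trans (rnormM _ _))//.
  apply: (@le_trans _ _ (K * (e / 2 / K))); last by rewrite mulrC divfK ?gt_eqF.
  rewrite ler_pM ?rnorm_ge0//; apply: Gd => a aG.
  by have := st a; rewrite mem_cat aG orbT lt_min => /(_ isT)/andP[].
apply: (@le_trans _ _ ((e / 2 / K) * K)); last by rewrite divfK ?gt_eqF.
rewrite ler_pM ?rnorm_ge0//; apply: Fd => a aF.
by have := st a; rewrite mem_cat aF lt_min => /(_ isT)/andP[].
Qed.
Definition tame_mul x y : tamefun := TameFun (mul_subproof x y).

Let star_subproof x : (fun t => star (x t)) \in tame_pred.
Proof.
apply/asboolP; split.
  by have [K xK] := tamefun_bounded x; exists K => t; rewrite rnormS.
move=> e /(tamefun_determined x)[F [d [d0 Fd]]]; exists F, d; split=> // s t st.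
by rewrite -starB rnormS Fd.
Qed.
Definition tame_star x : tamefun := TameFun (star_subproof x).

Let mulA : associative tame_mul.
Proof. by move=> x y z; apply: tamefunP => t; exact: amulA. Qed.
Let mulDl : left_distributive tame_mul +%R.
Proof. by move=> x y z; apply: tamefunP => t; exact: amulDl. Qed.
Let mulDr : right_distributive tame_mul +%R.
Proof. by move=> x y z; apply: tamefunP => t; exact: amulDr. Qed.
Let mulZl (c : R[i]) x y : tame_mul (c *: x) y = c *: tame_mul x y.
Proof. by apply: tamefunP => t; exact: amulZl. Qed.
Let mulZr (c : R[i]) x y : tame_mul x (c *: y) = c *: tame_mul x y.
Proof. by apply: tamefunP => t; exact: amulZr. Qed.
Let tstarK : involutive tame_star.
Proof. by move=> x; apply: tamefunP => t; exact: starK. Qed.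
Let tstarD : {morph tame_star : x y / x + y}.
Proof. by move=> x y; apply: tamefunP => t; exact: starD. Qed.
Let tstarZ (c : R[i]) x : tame_star (c *: x) = c^* *: tame_star x.
Proof. by apply: tamefunP => t; exact: starZ. Qed.
Let tstarM x y : tame_star (tame_mul x y) = tame_mul (tame_star y) (tame_star x).
Proof. by apply: tamefunP => t; exact: starM. Qed.
HB.instance Definition _ := isStarAlgebra.Build R tamefun mulA mulDl mulDr
  mulZl mulZr tstarK tstarD tstarZ tstarM.

Lemma tamefunM x y t : (x ** y) t = x t ** y t. Proof. by []. Qed.
Lemma tamefunS x t : (star x) t = star (x t). Proof. by []. Qed.

Let tame_normM x y : `|x ** y| <= `|x| * `|y|.
Proof.
rewrite !rnormE -rmorphM/= lecR; apply: tamenorm_le => t.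
by rewrite (le_trans (rnormM _ _))// ler_pM ?rnorm_ge0 ?le_tamenorm.
Qed.
HB.instance Definition _ := isNormedStarAlgebra.Build R tamefun tame_normM.

Let tame_norm_star x : `|star x ** x| = `|x| ^+ 2.
Proof.
rewrite !rnormE -rmorphXn; congr (_%:C); rewrite !rnorm_tamefun.
apply/eqP; rewrite eq_le; apply/andP; split.
  apply: tamenorm_le => t; rewrite [_ t]/= rnorm_starM.
  by rewrite ler_sqr ?nnegrE ?rnorm_ge0 ?tamenorm_ge0// le_tamenorm.
rewrite -[leRHS]sqr_sqrtr ?tamenorm_ge0// ler_sqr ?nnegrE ?tamenorm_ge0 ?sqrtr_ge0//.
apply: tamenorm_le => t; rewrite -[leLHS]ger0_norm ?rnorm_ge0// -sqrtr_sqr.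
by rewrite ler_sqrt ?tamenorm_ge0// -rnorm_starM; exact: (le_tamenorm (star x ** x)).
Qed.

Let tame_complete (F : set_system tamefun) : ProperFilter F -> cauchy F -> cvg F.
Proof.
apply: seq_complete => u uc.
have dist_le m n t : rnorm (u m t - u n t) <= rnorm (u m - u n).
  exact: (le_tamenorm (u m - u n) t).
have utc t : exists l : M, seq_cvg (@rnorm R M) (fun n => u n t) l.
  apply: seq_cauchy_cvg => e /uc[N NP]; exists N => m n Nm Nn.
  exact: le_lt_trans (dist_le _ _ _) (NP _ _ Nm Nn).
have /choice[l ul] := utc.
have ull (e : R) : 0 < e -> exists N, forall n, (N <= n)%N -> forall t,
    rnorm (u n t - l t) <= e.
  move=> e0; have e20 := divr_gt0 e0 (ltr0n R 2).
  have [N NP] := uc _ e20; exists N => n Nn t.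
  have [K KP] := ul t _ e20.
  rewrite -(subrKA (u (maxn K N) t)); apply: le_trans (rnormD _ _) _.
  rewrite (splitr e) lerD// ltW//.
    by apply: le_lt_trans (dist_le _ _ _) (NP _ _ _ _); rewrite ?leq_maxr.
  by apply: KP; rewrite leq_maxl.
have lT : l \in tame_pred.
  apply/asboolP; split.
    have [N /(_ N (leqnn N)) NP] := ull _ ltr01.
    have [K uK] := tamefun_bounded (u N); exists (1 + K) => t.
    rewrite -(subrK (u N t) (l t)) (le_trans (rnormD _ _))// lerD//.
    by rewrite rnormB.
  move=> e e0; have e30 : 0 < e / 3 by rewrite divr_gt0// ltr0n.
  have [N /(_ N (leqnn N)) NP] := ull _ e30.
  have [F0 [d [d0 Fd]]] := tamefun_determined (u N) e30.
  exists F0, d; split=> // s t /Fd st.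
  have -> : l s - l t = (l s - u N s) + ((u N s - u N t) + (u N t - l t)).
    by rewrite !subrKA.
  have e3 : e / 3 + (e / 3 + e / 3) = e by lra.
  rewrite -e3 (le_trans (rnormD _ _))// lerD//; first by rewrite rnormB NP.
  by rewrite (le_trans (rnormD _ _))// lerD.
exists (TameFun lT) => e e0; have [N NP] := ull _ (divr_gt0 e0 (ltr0n R 2)).
exists N => n /NP un; apply: (@le_lt_trans _ _ (e / 2)).
  exact: tamenorm_le.
by rewrite ltr_pdivrMr// ltr_pMr// ltr1n.
Qed.
HB.instance Definition _ := Uniform_isComplete.Build tamefun tame_complete.
HB.instance Definition _ := isCStarAlgebra.Build R tamefun tame_norm_star.

End TameFunctions.

Section UniversalLifting.
Variables (R : realType) (A M : cstarAlgType R).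
Local Notation T := (contraction A M).
Local Notation B := (tamefun A M).
Implicit Types (t : T) (x y : B) (a b : A).

Definition hom_point t := exists2 pi : {linear A -> M}, star_hom pi & t =1 pi.

Definition vanishing x := forall t, hom_point t -> x t = 0.

Let vanishing0 : vanishing 0. Proof. by move=> t _. Qed.
Let vanishingD x y : vanishing x -> vanishing y -> vanishing (x + y). 
Proof. by move=> x0 y0 t tz; rewrite tamefunD x0// y0// addr0. Qed.
Let vanishingZ (c : R[i]) x : vanishing x -> vanishing (c *: x).
Proof. by move=> x0 t tz; rewrite tamefunZ x0// scaler0. Qed.
Let vanishingMl x y : vanishing y -> vanishing (x ** y).
Proof. by move=> y0 t tz; rewrite tamefunM y0// amulx0. Qed.
Let vanishingMr x y : vanishing x -> vanishing (x ** y).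
Proof. by move=> x0 t tz; rewrite tamefunM x0// amul0x. Qed.
Let vanishingS x : vanishing x -> vanishing (star x).
Proof. by move=> x0 t tz; rewrite tamefunS x0// star0. Qed.

Definition vanishing_ideal : star_ideal B :=
  StarIdeal vanishing0 vanishingD vanishingZ vanishingMl vanishingMr vanishingS.

Let vanishing_closed : closed [set x | vanishing_ideal x].
Proof.
move=> x xJ t tz; apply: rnorm0_eq0; apply/eqP; rewrite eq_le rnorm_ge0 andbT.
apply/ler_addgt0Pl => e e0; rewrite addr0.
have [|y [yJ]] := xJ (ball x e%:C); first by apply: nbhsx_ballx; rewrite ltcR.
rewrite -ball_normE /ball_/= lt_rnorm => /ltW; apply: le_trans.
by rewrite -[x t]subr0 -(yJ t tz); exact: (le_tamenorm (x - y)).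
Qed.

(** In the quotient by this ideal the evaluations satisfy all the algebraic
    relations of A. *)
Definition hom_ideal : closed_ideal B := ClosedIdeal vanishing_closed.

Let coordinate_subproof a : (fun t : T => t a) \in @tame_pred R A M.
Proof.
apply/asboolP; split; first by exists (rnorm a) => t; exact: contractionP.
move=> e e0; exists [:: a], e; split=> // s t st.
by rewrite ltW// st ?mem_head.
Qed.
Definition coordinate a : B := TameFun (coordinate_subproof a).

Definition coordinate_class a : quotient hom_ideal :=
  quotient_pi hom_ideal (coordinate a).

Let coordinate_classP x a :
  (forall t, hom_point t -> x t = t a) -> quotient_pi hom_ideal x = coordinate_class a.
Proof.
move=> xa; apply/starquot_eqP => t tz.
by rewrite tamefunB xa// subrr.
Qed.

Let coordinate_linear : linear coordinate_class.
Proof.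
move=> c a b; rewrite -linearP; apply/esym/coordinate_classP => t [pi piH tpi].
by rewrite tamefunD tamefunZ /= !tpi linearP.
Qed.
HB.instance Definition _ := GRing.isLinear.Build R[i] A (quotient hom_ideal) *:%R
  coordinate_class coordinate_linear.

Let coordinateM a b : coordinate_class (a ** b) = coordinate_class a ** coordinate_class b.
Proof.
rewrite -quotient_piM; apply/esym/coordinate_classP => t [pi [piM piS] tpi].
by rewrite tamefunM /= !tpi piM.
Qed.

Let coordinateS a : coordinate_class (star a) = star (coordinate_class a).
Proof.
rewrite -[RHS](@starquot_piS R B hom_ideal).
apply/esym/coordinate_classP => t [pi [piM piS] tpi].
by rewrite tamefunS /= !tpi piS.
Qed.

(** The map a |-> class of the evaluation at a is a *-homomorphism into the
    quotient, contractive because all points are contractions; theta is a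
    lifting of it. It extends every *-homomorphism from A to M, seen as a point,
    to the values theta a t at arbitrary points t. *)
Lemma lifting_extension : lifting_property A ->
  exists2 theta : {linear A -> B}, completely_positive theta &
    forall a t, hom_point t -> theta a t = t a.
Proof.
move=> /(_ B hom_ideal coordinate_class)[]; first split.
- by apply: star_hom_completely_positive; split=> *; rewrite /= ?coordinateM ?coordinateS.
- move=> a; rewrite !rnormE lecR; apply: le_trans (quotient_norm_le _ _) _.
  by apply: tamenorm_le => t; exact: contractionP.
move=> theta [[thetaP _] thetaE]; exists theta => // a t tz.
have /starquot_eqP/(_ t tz) : quotient_pi hom_ideal (theta a) =
    quotient_pi hom_ideal (coordinate a) by exact: thetaE.
by rewrite tamefunB => /eqP; rewrite subr_eq0 => /eqP.
Qed.

End UniversalLifting.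

(** * Representations of C(X) by matrices *)

Section DiagonalRepresentations.
Variables (R : realType) (X : topologicalType) (cX : compact [set: X]) (n : nat).
Local Notation A := (contfun R cX).
Local Notation M := (matalg R n).

Definition eval_points (p : 'I_n -> X) (f : A) : M := diag_mx (\row_i f (p i)).

Lemma eval_points_linear p : linear (eval_points p).
Proof.
move=> c f g; apply/matrixP => i j; rewrite !mxE.
by case: eqP => _; rewrite ?mulr1n// !mulr0n mulr0 addr0.
Qed.
HB.instance Definition _ p := GRing.isLinear.Build R[i] A M *:%R
  (eval_points p) (eval_points_linear p).

Lemma eval_points_hom p : star_hom (eval_points p).
Proof.
split=> [f g|f].
  rewrite [RHS]mulmx_diag; congr diag_mx.
  by apply/rowP => i; rewrite !mxE.
apply/matrixP => i j; rewrite !mxE eq_sym.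
by case: eqP => [->|_]; rewrite ?mulr1n// !mulr0n conjC0.
Qed.

Lemma vnorm_diag (d u : 'rV[R[i]]_n) (m : R) : 0 <= m ->
  (forall i, complex.Re `|d 0 i| <= m) -> vnorm (u *m diag_mx d) <= m * vnorm u.
Proof.
move=> m0 dm; rewrite -(@ler_pXn2r _ 2)// ?nnegrE ?mulr_ge0 ?vnorm_ge0//.
rewrite exprMn !vnorm_sq -lecR rmorphM/= -!dotuuE /dot mulr_sumr.
apply: ler_sum => i _; rewrite mul_mx_diag mxE rmorphM mulrACA mulrC.
rewrite ler_wpM2r//; first exact: mulcJ_ge0.
by rewrite -normCK cabsE -rmorphXn lecR lerXn2r// ?nnegrE ?cabs_ge0.
Qed.

Lemma rnorm_diag (d : 'rV[R[i]]_n) (m : R) : 0 <= m ->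
  (forall i, complex.Re `|d 0 i| <= m) -> rnorm (diag_mx d : M) <= m.
Proof.
move=> m0 dm; apply: opnorm_le => u v u1 v1.
apply: le_trans (dot_CauchySchwarz _ _) _.
rewrite -[leRHS]mulr1 ler_pM ?vnorm_ge0//.
apply: le_trans (vnorm_diag _ m0 dm) _.
by rewrite -[leRHS]mulr1 ler_wpM2l.
Qed.

Lemma eval_points_contractive p f : rnorm (eval_points p f) <= rnorm f.
Proof.
apply: rnorm_diag => [|i]; first exact: rnorm_ge0.
by rewrite mxE; exact: (cabs_le_supnorm f).
Qed.

End DiagonalRepresentations.

Section Conjugation.
Variables (R : realType) (A : cstarAlgType R) (n : nat).
Local Notation M := (matalg R n).
Variables (pi : {linear A -> M}) (w : M).

Definition conjugate_hom (a : A) : M := w ** pi a ** star w.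

Let conjugate_linear : linear conjugate_hom.
Proof.
move=> c a b; rewrite /conjugate_hom linearP.
by rewrite amulDr amulDl amulZr amulZl.
Qed.
HB.instance Definition _ := GRing.isLinear.Build R[i] A M *:%R
  conjugate_hom conjugate_linear.

Hypothesis w_unitary : star w ** w = 1%:M.

Lemma amul1m (x : M) : (1%:M : M) ** x = x. Proof. exact: mul1mx. Qed.

Lemma conjugate_star_hom : star_hom pi -> star_hom conjugate_hom.
Proof.
move=> [piM piS]; split=> [a b|a]; rewrite /= /conjugate_hom.
  rewrite piM -!amulA; congr (_ ** (_ ** _)).
  by rewrite [RHS]amulA w_unitary amul1m.
by rewrite piS !starM starK amulA.
Qed.

Lemma rnorm_unitary_le1 : rnorm w <= 1.
Proof.
rewrite -(@ler_sqr _ _ 1) ?nnegrE ?rnorm_ge0// expr1n -rnorm_starM w_unitary.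
have -> : 1%:M = diag_mx (const_mx 1) :> M by rewrite diag_const_mx.
by apply: rnorm_diag => // i; rewrite mxE normr1.
Qed.

Lemma conjugate_contractive a : rnorm (pi a) <= rnorm a ->
  rnorm (conjugate_hom a) <= rnorm a.
Proof.
move=> pia; apply: le_trans (rnormM _ _) _; rewrite rnormS.
rewrite -[leRHS]mulr1 ler_pM ?rnorm_ge0 ?rnorm_unitary_le1//.
apply: le_trans (rnormM _ _) _.
by rewrite -[leRHS]mul1r ler_pM ?rnorm_ge0 ?rnorm_unitary_le1.
Qed.

End Conjugation.

Section Rotation.
Variable R : realType.

(** The angle is chosen so that all entries are rational. *)
Definition rotation : matalg R 2 := \matrix_(i, j)
  if i == j then 3 / 5 else if i == 0 then - (4 / 5) else 4 / 5.

Lemma conj_ratio (p q : nat) : ((p%:R / q%:R : R[i])^*)%R = p%:R / q%:R.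
Proof. by rewrite rmorphM/= fmorphV !rmorph_nat. Qed.

Lemma rotation_unitary : star rotation ** rotation = 1%:M.
Proof.
have r35 : ((3 / 5 : R[i])^*)%R = 3 / 5 := conj_ratio 3 5.
have r45 : ((4 / 5 : R[i])^*)%R = 4 / 5 := conj_ratio 4 5.
apply/matrixP => i j; rewrite [LHS]mxE !big_ord_recl big_ord0 !mxE/=.
case: i => [[|[|//]] ?]; case: j => [[|[|//]] ?] /=;
  rewrite /= ?rmorphN/= ?r35 ?r45; field; rewrite ?pnatr_eq0//.
Qed.

Lemma rotation_conj01 (c d : R[i]) :
  (rotation ** (diag_mx (\row_i if i == 0 then c else d) : matalg R 2) **
    star rotation) 0 1 = 12 / 25 * (c - d).
Proof.
have r35 : ((3 / 5 : R[i])^*)%R = 3 / 5 := conj_ratio 3 5.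
have r45 : ((4 / 5 : R[i])^*)%R = 4 / 5 := conj_ratio 4 5.
rewrite [LHS]mxE !big_ord_recl big_ord0 !mxE !big_ord_recl !big_ord0 !mxE/=.
by rewrite !mulr1n !mulr0n ?r35 ?r45; field; rewrite ?pnatr_eq0//.
Qed.

End Rotation.

(** A positive matrix dominated by a matrix with a zero on the diagonal has zero
    row and column there: the diagonal entry is a sum of squares of the
    entries of the k-th columns of y and z. *)
Lemma positive_sum_diag0 (R : realType) (n : nat) (y z : matalg R n) k j :
  (star y ** y + star z ** z) k k = 0 ->
  (star y ** y) k j = 0 /\ (star y ** y) j k = 0.
Proof.
have kkE (x : matalg R n) : (star x ** x) k k = \sum_i `|x i k| ^+ 2.
  rewrite [LHS]mxE; apply: eq_bigr => i _.
  by rewrite [star x _ _]mxE mulrC normCK.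
have sq0 (x : matalg R n) : 0 <= \sum_i `|x i k| ^+ 2.
  by apply: sumr_ge0 => i _; rewrite exprn_ge0.
rewrite mxE !kkE => /eqP; rewrite paddr_eq0// psumr_eq0 => [|i _]; last first.
  by rewrite exprn_ge0.
move=> /andP[/allP y0 _].
have {}y0 i : y i k = 0.
  by apply/eqP; have := y0 i (mem_index_enum i); rewrite sqrf_eq0 normr_eq0.
split; rewrite [LHS]mxE big1// => i _; rewrite [star y _ _]mxE y0.
  by rewrite conjC0 mul0r.
by rewrite mulr0.
Qed.


(** * Countable families and G_delta points *)

Section CountableClosure.
Variables (T : Type) (D : T -> set T).

Fixpoint closure_step (S0 : set T) (n : nat) : set T :=
  if n is m.+1 then \bigcup_(x in closure_step S0 m) D x else S0.

(** Iterate S |-> union of the D x for x in S, and take the union. *)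
Lemma countable_closure (S0 : set T) :
  (forall x, countable (D x)) -> countable S0 ->
  exists S : set T, [/\ countable S, S0 `<=` S & forall x, S x -> D x `<=` S].
Proof.
move=> cD cS0; exists (\bigcup_n closure_step S0 n); split.
- apply: bigcup_countable => // n _.
  by elim: n => //= n IHn; exact: bigcup_countable.
- by move=> x Sx; exists 0%N.
- by move=> x [n _ nx] y Dy; exists n.+1 => //=; exists x.
Qed.

End CountableClosure.

Lemma Gdelta_bigcap_countable (X : topologicalType) (T : Type) (S : set T)
    (U : T -> set X) : countable S -> (forall i, open (U i)) ->
  Gdelta (\bigcap_(i in S) U i).
Proof.
move=> /countable_injP[f fI] oU.
(* The n-th open set is U i if f i = n, and the whole space if n is not
   the code of an element of S. *)
exists (fun n => [set y | forall i, S i -> f i = n -> U i y]).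
  move=> n; have [[i Si fi]|ni] := pselect (exists2 i, S i & f i = n).
    rewrite (_ : mkset _ = U i)//; apply/seteqP; split=> [y /(_ i Si fi)//|y yU j Sj fj].
    by rewrite (_ : j = i)//; apply: fI; rewrite ?inE// fi fj.
  rewrite (_ : mkset _ = setT); first exact: openT.
  by apply/seteqP; split=> // y _ i Si fi; case: ni; exists i.
apply/seteqP; split=> [y yU n _ i Si _|y yU i Si]; first exact: yU.
exact: (yU (f i) I i Si erefl).
Qed.

Section RealContinuousFunctions.
Variables (R : realType) (X : topologicalType) (cX : compact [set: X]).

Lemma real_contfun_subproof (r : X -> R) : continuous r ->
  (fun x => (r x)%:C) \in @continuous_pred R X.
Proof.
move=> rc; apply/continuous_predP/continuousCP => x e e0.
have /cvgrPdist_lt/(_ e e0) := rc x; apply: filterS => y.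
by rewrite -(rmorphB (real_complex R)) cabs_realN.
Qed.

Definition real_contfun (r : X -> R) (rc : continuous r) : contfun R cX :=
  ContFun cX (real_contfun_subproof rc).

(** The witness is the square root of r. *)
Lemma real_contfun_pos (r : X -> R) (rc : continuous r) : (forall x, 0 <= r x) ->
  exists f : contfun R cX, real_contfun rc = star f ** f.
Proof.
move=> r0.
have sc : continuous (fun x => Num.sqrt (r x)).
  by move=> x; apply: continuous_comp; [exact: rc|exact: sqrt_continuous].
exists (real_contfun sc); apply: contfunP => x.
change ((r x)%:C = ((Num.sqrt (r x))%:C)^*%C * (Num.sqrt (r x))%:C).
by rewrite conjc_real -(rmorphM (real_complex R)) -expr2 sqr_sqrtr.
Qed.

Lemma urysohn_pair (x y : X) : hausdorff_space X -> x <> y ->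
  exists r : X -> R, [/\ continuous r, r x = 1, r y = 0 & forall z, 0 <= r z <= 1].
Proof.
move=> hX xy; have cl z : closed [set z : X].
  exact: accessible_closed_set1 (hausdorff_accessible hX) z.
have yx0 : [set y] `&` [set x] = set0.
  by apply/seteqP; split=> // z [-> yx]; exact: xy.
have [r [rc r0 r1 r01]] :=
  urysohn_ext_itv (compact_normal hX cX) (cl y) (cl x) yx0 (@ltr01 R).
exists r; split=> //.
- by apply: r1; exists x.
- by apply: r0; exists y.
- by move=> z; have := r01 (r z) (ex_intro2 _ _ z I erefl); rewrite /= in_itv.
Qed.

End RealContinuousFunctions.

(** The coordinates needed for the precisions 1, 1/2, 1/3, ... together
    determine the value exactly. *)
Lemma tamefun_countably_determined (R : realType) (A M : cstarAlgType R)
    (f : tamefun A M) :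
  exists D : set A, countable D /\
    forall s t : contraction A M, (forall a, D a -> s a = t a) -> f s = f t.
Proof.
have e0 n : 0 < (n.+1%:R^-1 : R) by rewrite invr_gt0 ltr0n.
have /choice[F FP] := fun n => tamefun_determined f (e0 n).
exists (\bigcup_n [set` F n]); split.
  by apply: bigcup_countable => // n _; apply: finite_set_countable.
move=> s t st; apply/eqP; rewrite -subr_eq0; apply/eqP/rnorm0_eq0/eqP.
rewrite eq_le rnorm_ge0 andbT; apply/ler_addgt0Pl => e e_gt0; rewrite addr0.
have [N _ NP] := near_infty_natSinv_lt (PosNum e_gt0).
apply: le_trans (ltW (NP N (leqnn N))).
have [d [d0 Fd]] := FP N; apply: Fd => a aF.
by rewrite st ?subrr ?rnorm0//; exists N.
Qed.

(** A cluster point of an injective sequence: each of its neighbourhoods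
    contains infinitely many terms of the sequence, in particular two. *)
Lemma compact_infinite_accumulation (X : topologicalType) :
  compact [set: X] -> infinite_set [set: X] ->
  exists (z : nat -> X) (x : X), injective z /\
    forall N : set X, nbhs x N -> exists j k, [/\ j <> k, N (z j) & N (z k)].
Proof.
move=> cX /infiniteP/card_leP[h].
pose z n : X := \val (h (SigSub (mem_set (I : [set: nat] n)))).
have zI : injective z.
  by move=> j k /val_inj/(inj (mem_set I) (mem_set I))/(congr1 val).
have [|x [_ clx]] := cX (z @ \oo) _; first exact: filterT.
exists z, x; split=> // N Nx.
have far m : exists2 k, (m <= k)%N & N (z k).
  have [|_ [[k /= mk <-] Nk]] := clx [set z k | k in [set k | (m <= k)%N]] N _ Nx.
    by exists m => // k /= mk; exists k.
  by exists k.
have [j _ Nj] := far 0%N; have [k jk Nk] := far j.+1.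
by exists j, k; split=> // jkE; rewrite jkE ltnn in jk.
Qed.

Section CompactWithoutGdelta.
Variables (R : realType) (X : topologicalType) (cX : compact [set: X]).
Local Notation A := (contfun R cX).
Local Notation M := (matalg R 2).
Hypotheses (hX : hausdorff_space X) (X0 : [set: X] !=set0).
Hypothesis noGdelta : forall x : X, ~ Gdelta [set x].

Lemma without_Gdelta_infinite : infinite_set [set: X].
Proof.
move=> fX; have [x _] := X0; apply: (noGdelta (x := x)); apply: open_Gdelta.
rewrite -[X in open X]setCK; apply: closed_openC.
apply: (accessible_finite_set_closed.1 (hausdorff_accessible hX)).
exact: sub_finite_set fX.
Qed.

(** Otherwise the countably many open conditions |f x - f y| < 1/(m+1), for f in
    S, would define {x}. *)
Lemma countable_agree (S : set A) (x : X) : countable S ->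
  exists2 x', x <> x' & forall f, S f -> f x = f x'.
Proof.
move=> cS; apply: contrapT => nx; apply: (noGdelta (x := x)).
pose U (p : A * nat) := [set y | complex.Re `|p.1 x - p.1 y| < p.2.+1%:R^-1].
rewrite (_ : [set x] = \bigcap_(p in S `*` [set: nat]) U p); last first.
  apply/seteqP; split=> [_ -> [f m] _|y yU].
    by rewrite /U /mkset subrr normr0 invr_gt0 ltr0n.
  apply: contrapT => yx; apply: nx; exists y => [xy|f Sf]; first exact: yx.
  apply/eqP; rewrite -subr_eq0 -normr_eq0 cabsE.
  suff -> : complex.Re `|f x - f y| = 0 by [].
  apply/eqP; rewrite eq_le cabs_ge0 andbT.
  apply/ler_addgt0Pl => e e0; rewrite addr0.
  have [N _ NP] := near_infty_natSinv_lt (PosNum e0).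
  by rewrite (le_trans _ (ltW (NP N (leqnn N))))// ltW//; exact: (yU (f, N)).
apply: Gdelta_bigcap_countable => [|[f m]].
  exact: countableX.
rewrite openE /U => y fy.
have e0 : 0 < m.+1%:R^-1 - complex.Re `|f x - f y| by rewrite subr_gt0.
apply: filterS ((continuousCP f).1 (@contfun_continuous _ _ _ f) y _ e0) => w.
move=> fw; rewrite /mkset -(subrKA (f y)); apply: le_lt_trans (cabsD _ _) _.
by rewrite -ltrBrDl.
Qed.

End CompactWithoutGdelta.

(** * Failure of the lifting property for C(X) *)

Section NoLifting.
Variables (R : realType) (X : topologicalType) (cX : compact [set: X]).
Local Notation A := (contfun R cX).
Local Notation M := (matalg R 2).
Local Notation T := (contraction A M).
Implicit Types (x y : X) (a : A) (s t : T).

Definition point_pair (x y : X) (i : 'I_2) := if i == 0 then x else y.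

Definition diagonal_point (x y : X) : T :=
  Contraction (eval_points_contractive (cX := cX) (point_pair x y)).

Definition rotated_point (x y : X) : T :=
  Contraction (fun a => conjugate_contractive (rotation_unitary R)
    (eval_points_contractive (point_pair x y) a)).

Let splice_subproof (S : set A) (s t : T) a :
  rnorm (if `[< S a >] then s a else t a) <= rnorm a.
Proof. by case: ifP => _; exact: contractionP. Qed.

(** Not a linear map in general: this is where the points of the universal
    problem have to be more than *-homomorphisms. *)
Definition splice (S : set A) (s t : T) : T := Contraction (splice_subproof S s t).

Lemma diagonal_pointE x y a i j :
  diagonal_point x y a i j = (if i == 0 then a x else a y) *+ (i == j).
Proof. by rewrite !mxE /point_pair; case: ifP. Qed.

Lemma hom_diagonal_point x y : hom_point (diagonal_point x y).
Proof. by exists (eval_points (cX := cX) (point_pair x y)); first exact: eval_points_hom. Qed.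

Lemma hom_rotated_point x y : hom_point (rotated_point x y).
Proof.
exists (conjugate_hom (eval_points (cX := cX) (point_pair x y)) (rotation R)) => //.
by apply: conjugate_star_hom; [exact: rotation_unitary|exact: eval_points_hom].
Qed.

Lemma rotated_point01 x y a : rotated_point x y a 0 1 = 12 / 25 * (a x - a y).
Proof.
rewrite -rotation_conj01; rewrite /= /conjugate_hom.
congr ((rotation R ** diag_mx _ ** _ : M) 0 1).
by apply/rowP => i; rewrite !mxE /point_pair; case: ifP.
Qed.

(** Where a does not separate x and x' the diagonal matrix is scalar, and
    conjugation does not change it. *)
Lemma rotated_point_eq x x' a : a x = a x' -> rotated_point x x' a = diagonal_point x x a.
Proof.
move=> axx'; change (rotation R ** eval_points (point_pair x x') a ** star (rotation R)
  = eval_points (point_pair x x) a).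
have -> : eval_points (point_pair x x') a = (a x)%:M.
  apply/matrixP => i j; rewrite !mxE /point_pair.
  by case: (i == 0) => //; rewrite axx'.
have -> : eval_points (point_pair x x) a = (a x)%:M.
  by apply/matrixP => i j; rewrite !mxE /point_pair if_same.
have -> : rotation R ** (a x)%:M = a x *: rotation R := mul_mx_scalar _ _.
rewrite amulZl.
have -> : rotation R ** star (rotation R) = 1%:M.
  by apply: mulmx1C; exact: rotation_unitary.
by rewrite scalemx1.
Qed.

Lemma rnorm_diagonal_pointB x y z a (d : R) : 0 <= d ->
  complex.Re `|a x - a y| <= d -> complex.Re `|a x - a z| <= d ->
  rnorm (diagonal_point y z a - diagonal_point x x a) <= d.
Proof.
move=> d0 xy xz; rewrite [_ - _](_ : _ = diag_mx (\row_i (a (point_pair y z i) - a x))).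
  apply: rnorm_diag => // i; rewrite mxE /point_pair; case: ifP => _.
    by rewrite -normrN opprB.
  by rewrite -normrN opprB.
apply/matrixP => i j; rewrite !mxE /point_pair if_same.
by case: (i == j); rewrite ?mulr1n// !mulr0n subrr.
Qed.

(** If 0 <= p <= p + q, then the off-diagonal entries of theta p are controlled by
    the diagonal of theta (p + q). *)
Lemma positive_map_diag0 (theta : {linear A -> tamefun A M})
    (t : T) (p q : A) k j : completely_positive theta ->
  (exists a, p = star a ** a) -> (exists b, q = star b ** b) ->
  theta (p + q) t k k = 0 -> theta p t k j = 0 /\ theta p t j k = 0.
Proof.
move=> thetaP [a ->] [b ->]; rewrite linearD tamefunD.
have [y ->] := completely_positive_pos a thetaP.
have [z ->] := completely_positive_pos b thetaP.
rewrite !tamefunM !tamefunS; exact: positive_sum_diag0.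
Qed.

Hypotheses (hX : hausdorff_space X) (X0 : [set: X] !=set0).
Hypothesis noGdelta : forall x : X, ~ Gdelta [set x].

(** For the point t and the function h built in the proof, theta h t has to be
    diagonal by positivity, and within 1 / 5 of rotated_point x x' h, whose
    off-diagonal entry is 12 / 25, by continuity. *)
Theorem compact_without_Gdelta_no_lifting : ~ lifting_property A.
Proof.
move=> /(lifting_extension M)[theta thetaP thetaE].
have [z [x [zI zx]]] :=
  compact_infinite_accumulation cX (without_Gdelta_infinite hX X0 noGdelta).
have /choice[r rP] : forall p : nat * nat, exists r : X -> R,
    [/\ continuous r, forall y, 0 <= r y <= 1 &
        p.1 <> p.2 -> r (z p.1) = 1 /\ r (z p.2) = 0].
  move=> [j k]; have [jk|jk] := eqVneq j k.
    exists (fun=> 0); split=> [y|y|/(_ jk)//]; first exact: cvg_cst.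
    by rewrite lexx ler01.
  have [|r [rc r1 r0 r01]] := @urysohn_pair R X cX (z j) (z k) hX.
    by move=> /zI jkE; rewrite jkE eqxx in jk.
  by exists r.
have rc p : continuous (r p) by have [] := rP p.
pose g p : A := real_contfun cX (rc p).
have cst1 : continuous (fun _ : X => 1 : R) by move=> y; exact: cvg_cst.
pose one : A := real_contfun cX cst1.
have /choice[D DP] := fun a => tamefun_countably_determined (theta a).
(* Besides the separating functions, S contains 1, because the argument below
   uses 1 - g for a separating function g. *)
have [||S [cS S0 SD]] := @countable_closure A D (range g `|` [set one]).
- by move=> a; have [] := DP a.
- rewrite -bigcup2E; apply: bigcup_countable => // -[|[|n]] _ /=.
  + by apply: sub_countable (countableP [set: nat * nat]); exact: card_image_le.
  + exact: countable1.
  + exact: countable0.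
have [x' xx' Sxx'] := countable_agree noGdelta x cS.
have [h0 [hc hx hx' h01]] := @urysohn_pair R X cX x x' hX xx'.
pose h : A := real_contfun cX hc.
(* Any precision below 12 / 25, the off-diagonal entry of rotated_point, works. *)
have e0 : 0 < 1 / 5 :> R by rewrite divr_gt0.
have [F [d [d0 Fd]]] := tamefun_determined (theta h) e0.
have : \forall y \near x, forall f, f \in F -> complex.Re `|f x - f y| < d.
  elim: F {Fd} => [|f F IHF]; first by near=> y.
  have fx := (continuousCP f).1 (@contfun_continuous _ _ _ f) x _ d0.
  near=> y => a; rewrite inE => /predU1P[->|]; first by near: y.
  by move: a; near: y.
move=> /zx[j [k [jk zj zk]]].
pose t := splice S (diagonal_point (z j) (z k)) (rotated_point x x').
have thh : rnorm (theta h t - theta h (rotated_point x x')) <= 1 / 5.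
  apply: Fd => a aF; rewrite [t a]/=; case: asboolP => [Sa|_]; last first.
    by rewrite subrr rnorm0.
  rewrite (rotated_point_eq (Sxx' _ Sa)).
  (* rnorm_diagonal_pointB gives a weak inequality, and a strict one is
     needed: use the maximum of the two distances. *)
  have [d' d'd [ja ka]] : exists2 d' : R, d' < d &
      complex.Re `|a x - a (z j)| <= d' /\ complex.Re `|a x - a (z k)| <= d'.
    exists (Num.max (complex.Re `|a x - a (z j)|) (complex.Re `|a x - a (z k)|)).
      by rewrite gt_max zj// zk.
    by rewrite !le_max !lexx orbT.
  apply: le_lt_trans d'd; apply: rnorm_diagonal_pointB => //.
  exact: le_trans (cabs_ge0 _) ja.
have thS a : S a -> theta a t = diagonal_point (z j) (z k) a.
  move=> Sa; rewrite -(thetaE _ _ (hom_diagonal_point _ _)).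
  apply: (DP a).2 => b /(SD a Sa) Sb.
  by rewrite /t /=; case: asboolP.
have [_ r01 /(_ jk)[rj rk]] := rP (j, k).
have gS : S (g (j, k)) by apply: S0; left; exists (j, k).
have oneS : S one by apply: S0; right.
(* Write h = h g + h (1 - g). The two terms are dominated by g and 1 - g, whose
   images at t are diag(1, 0) and diag(0, 1). *)
have hgc : continuous (fun y => h0 y * r (j, k) y).
  by move=> y; apply: (cvgM (hc y) (rc (j, k) y)).
have hgc' : continuous (fun y => h0 y * (1 - r (j, k) y)).
  by move=> y; apply: (cvgM (hc y)); apply: (cvgB (cvg_cst _) (rc (j, k) y)).
have gc1 : continuous (fun y => (1 - h0 y) * r (j, k) y).
  by move=> y; apply: (cvgM _ (rc (j, k) y)); apply: (cvgB (cvg_cst _) (hc y)).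
have gc2 : continuous (fun y => (1 - h0 y) * (1 - r (j, k) y)).
  move=> y; apply: cvgM; apply: (cvgB (cvg_cst _)); [exact: hc|exact: rc].
have pos0 y : 0 <= h0 y by have /andP[] := h01 y.
have pos1 y : 0 <= 1 - h0 y by rewrite subr_ge0; have /andP[] := h01 y.
have pos2 y : 0 <= r (j, k) y by have /andP[] := r01 y.
have pos3 y : 0 <= 1 - r (j, k) y by rewrite subr_ge0; have /andP[] := r01 y.
have [_ P0] : theta (real_contfun cX hgc) t 1 0 = 0 /\
    theta (real_contfun cX hgc) t 0 1 = 0.
  apply: (@positive_map_diag0 theta t _ (real_contfun cX gc1)) => //.
  - by apply: real_contfun_pos => y; rewrite mulr_ge0.
  - by apply: real_contfun_pos => y; rewrite mulr_ge0.
  have -> : real_contfun cX hgc + real_contfun cX gc1 = g (j, k).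
    apply: contfunP => y; rewrite contfunD /= -(rmorphD (real_complex R)).
    by rewrite -mulrDl subrKC mul1r.
  by rewrite thS// diagonal_pointE /= rk mulr1n.
have [Q0 _] : theta (real_contfun cX hgc') t 0 1 = 0 /\
    theta (real_contfun cX hgc') t 1 0 = 0.
  apply: (@positive_map_diag0 theta t _ (real_contfun cX gc2)) => //.
  - by apply: real_contfun_pos => y; rewrite mulr_ge0.
  - by apply: real_contfun_pos => y; rewrite mulr_ge0.
  have -> : real_contfun cX hgc' + real_contfun cX gc2 = one - g (j, k).
    apply: contfunP => y; rewrite contfunD contfunB /=.
    rewrite -(rmorphD (real_complex R)) -(rmorphB (real_complex R)).
    by rewrite -mulrDl subrKC mul1r.
  rewrite linearB tamefunB !thS// mxE [X in _ + X]mxE !diagonal_pointE /= rj mulr1n.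
  by rewrite subrr.
have hE : h = real_contfun cX hgc + real_contfun cX hgc'.
  apply: contfunP => y; rewrite contfunD /= -(rmorphD (real_complex R)).
  by rewrite -mulrDr subrKC mulr1.
have th0 : theta h t 0 1 = 0.
  by rewrite hE linearD tamefunD mxE P0 Q0 addr0.
have := le_trans (opnorm_ge_entry (theta h t - theta h (rotated_point x x')) 0 1) thh.
rewrite mxE [X in _ + X]mxE th0 add0r normrN.
rewrite (thetaE _ _ (hom_rotated_point _ _)) rotated_point01.
have -> : h x - h x' = 1.
  change ((h0 x)%:C - (h0 x')%:C = 1 :> R[i]).
  by rewrite hx hx' rmorph0 subr0.
have -> : 12 / 25 * 1 = (12 / 25 : R)%:C :> R[i].
  by rewrite mulr1 rmorphM/= fmorphV !rmorph_nat.
by rewrite cabs_real; lra.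
Unshelve. all: by end_near.
Qed.

End NoLifting.

(** * Isomorphisms and completions *)

Section LiftingTransfer.
Variables (R : realType) (A A' : cstarAlgType R) (Phi : {linear A -> A'}).

Lemma lifting_property_isomorphism :
  star_isomorphism Phi -> (forall a, `|Phi a| = `|a|) ->
  lifting_property A -> lifting_property A'.
Proof.
move=> [[PhiM PhiS] [Psi PsiK PhiK]] PhiN LP B J phi [phiP phiN].
have Psi_linear : linear Psi by exact: (can2_linear PsiK PhiK).
pose PsiL : {linear A' -> A} :=
  HB.pack Psi (GRing.isLinear.Build R[i] A' A *:%R Psi Psi_linear).
have PsiH : star_hom PsiL.
  split=> [x y|x]; apply: (can_inj PsiK).
    by rewrite PhiM /= !PhiK.
  by rewrite PhiS /= !PhiK.
have [|theta [[thetaP thetaN] thetaE]] := LP B J (phi \o Phi : {linear A -> quotient J}).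
  split; first exact: completely_positive_comp (star_hom_completely_positive _).
  by move=> a; rewrite /= -(PhiN a); exact: phiN.
exists (theta \o PsiL : {linear A' -> B}); split; last first.
  by move=> a; rewrite /= thetaE /= PhiK.
split; first exact: completely_positive_comp (star_hom_completely_positive PsiH).
by move=> a; rewrite /= -[X in _ <= `|X|]PhiK PhiN; exact: thetaN.
Qed.

End LiftingTransfer.

Section CompletionExtension.
Variables (R : realType) (V : starAlgType R) (p : cstar_seminorm V).
Variables (B : cstarAlgType R) (F : {linear V -> B}).
Hypotheses (FH : star_hom F) (FN : forall x, rnorm (F x) = p x).
Local Notation E := (completion p).
Local Notation W := (cauchy_sequence p).

Let image_cvg (u : W) : exists b, seq_cvg (@rnorm R B) (fun n => F (u n)) b.
Proof.
apply: seq_cauchy_cvg => e e0; have [N NP] := cauchy_sequenceP u e0.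
by exists N => m n Nm Nn; rewrite -linearB FN NP.
Qed.

(** The limit is taken along a chosen representative of q;
    completion_extensionP shows that any other Cauchy sequence will do. *)
Definition completion_extension (q : E) : B := sval (cid (image_cvg (starquot_repr q))).

Lemma completion_extensionP (u : W) :
  seq_cvg (@rnorm R B) (fun n => F (u n)) (completion_extension (completion_class u)).
Proof.
set q := completion_class u.
have repr_cvg : seq_cvg (@rnorm R B) (fun n => F (starquot_repr q n)) (completion_extension q).
  exact: (svalP (cid (image_cvg (starquot_repr q)))).
have /starquot_eqP uq : completion_class u = completion_class (starquot_repr q).
  by apply/esym; exact: starquot_reprK.
move=> e e0; have e20 := divr_gt0 e0 (ltr0n R 2).
have [N NP] := repr_cvg _ e20.
have : (fun n => p ((u - starquot_repr q) n)) @ \oo --> limit_norm (u - starquot_repr q).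
  exact: cauchy_cvg_norm.
(* Two representatives differ by a null sequence, and F is isometric. *)
rewrite uq => /cvgrPdist_lt/(_ _ e20)[K _ KP].
exists (maxn N K) => n; rewrite geq_max => /andP[/NP Nn /KP].
rewrite sub0r normrN ger0_norm ?seminorm_ge0// => Kn.
rewrite -(subrKA (F (starquot_repr q n))) (le_lt_trans (rnormD _ _))//.
by rewrite (splitr e) ltrD// -linearB FN.
Qed.

Lemma completion_extension_linear : linear completion_extension.
Proof.
move=> c q r; have [u <-] := completion_surj q; have [v <-] := completion_surj r.
rewrite -linearP; apply: seq_cvg_unique (completion_extensionP _) _.
have := seq_cvg_linear c (completion_extensionP u) (completion_extensionP v).
by congr seq_cvg; apply/funext => n; rewrite -linearP.
Qed.
HB.instance Definition _ := GRing.isLinear.Build R[i] E B *:%R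
  completion_extension completion_extension_linear.

Lemma completion_extension_hom : star_hom completion_extension.
Proof.
have [FM FS] := FH.
split=> [q r|q]; have [u <-] := completion_surj q.
  have [v <-] := completion_surj r.
  have -> : completion_class u ** completion_class v = completion_class (u ** v).
    by apply/esym; exact: starquot_piM.
  apply: seq_cvg_unique (completion_extensionP _) _.
  have [K K0 vK] := cauchy_bounded v.
  have := seq_cvgM K0 _ (completion_extensionP u) (completion_extensionP v).
  rewrite (_ : (fun n => _ ** _) = (fun n => F ((u ** v) n))); last first.
    by apply/funext => n; rewrite -FM.
  by apply=> n; rewrite FN.
have -> : star (completion_class u) = completion_class (star u).
  by apply/esym; exact: starquot_piS.
apply: seq_cvg_unique (completion_extensionP _) _.
have := seq_cvg_star (completion_extensionP u).
by congr seq_cvg; apply/funext => n; rewrite -FS.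
Qed.

Lemma completion_extension_isometry q : rnorm (completion_extension q) = rnorm q.
Proof.
have [u <-] := completion_surj q; rewrite rnorm_completion.
have := seq_cvg_rnorm (completion_extensionP u).
under eq_fun do rewrite FN.
by move=> /cvg_lim <-.
Qed.

Lemma completion_extension_in x : completion_extension (completion_in p x) = F x.
Proof.
apply: seq_cvg_unique (completion_extensionP (cauchy_cst p x)) _ => e e0.
by exists 0%N => n _; rewrite subrr rnorm0.
Qed.

Lemma completion_extension_isomorphism :
  (forall b (e : R), 0 < e -> exists x, rnorm (F x - b) < e) ->
  star_isomorphism completion_extension.
Proof.
move=> Fdense; split; first exact: completion_extension_hom.
have inj : injective completion_extension.
  move=> q r qr; apply/eqP; rewrite -subr_eq0; apply/eqP/rnorm0_eq0.
  by rewrite -completion_extension_isometry linearB /= qr subrr rnorm0.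
suff surj b : exists q, completion_extension q = b.
  have /choice[g gK] := surj.
  by exists g => // q; apply: inj; rewrite gK.
have e0 n : 0 < (n.+1%:R^-1 : R) by rewrite invr_gt0 ltr0n.
have /choice[x xb] := fun n => Fdense b _ (e0 n).
have xcvg : seq_cvg (@rnorm R B) (fun n => F (x n)) b.
  move=> e e_gt0; have [N _ NP] := near_infty_natSinv_lt (PosNum e_gt0).
  by exists N => n /NP; exact: lt_trans.
have xc : x \in cauchy_pred p.
  apply/asboolP => e e_gt0; have e20 := divr_gt0 e_gt0 (ltr0n R 2).
  have [N NP] := xcvg _ e20; exists N => m n /NP Nm /NP Nn.
  rewrite -FN linearB /= -(subrKA b) (le_lt_trans (rnormD _ _))//.
  by rewrite (splitr e) ltrD// rnormB.
exists (completion_class (CauchySequence xc)).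
exact: seq_cvg_unique (completion_extensionP (CauchySequence xc)) xcvg.
Qed.

End CompletionExtension.

(** * The full norm of the group algebra of a Boolean group *)

Section SpanningFamily.
Variables (R : realType) (V E : starAlgType R) (I : Type) (d : I -> V).
Hypothesis d_ind : forall P : V -> Prop, P 0 ->
  (forall (c : R[i]) i x, P x -> P (c *: d i + x)) -> forall x, P x.

Lemma star_hom_spanning (f : {linear V -> E}) :
  (forall i j, f (d i ** d j) = f (d i) ** f (d j)) ->
  (forall i, f (star (d i)) = star (f (d i))) -> star_hom f.
Proof.
move=> fM fS.
split=> [x y|x].
  elim/d_ind: x => [|c i x IHx]; first by rewrite amul0x linear0 amul0x.
  rewrite amulDl !linearD IHx amulDl amulZl !linearZ amulZl; congr (_ *: _ + _).
  elim/d_ind: y {IHx} => [|e j y IHy]; first by rewrite amulx0 linear0 amulx0.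
  by rewrite amulDr !linearD IHy amulDr amulZr !linearZ amulZr fM.
elim/d_ind: x => [|c i x IHx]; first by rewrite star0 linear0 star0.
by rewrite starD starZ !linearD starD IHx !linearZ starZ fS.
Qed.

End SpanningFamily.

Section GroupAlgebraTheory.
Variables (R : realType) (G : groupType).
Local Notation CG := (group_algebra R G).
Implicit Types (x y : CG) (g h : G).

Lemma linear_extension_star_hom (E : starAlgType R) (u : G -> E) :
  (forall g h, u (g * h)%g = u g ** u h) -> (forall g, u (g^-1)%g = star (u g)) ->
  star_hom (linear_extension u : {linear CG -> E}).
Proof.
move=> uM uV; apply: (star_hom_spanning (@group_algebra_ind R G)) => [g h|g].
  by rewrite amul_gdelta /= !linear_extension_gdelta.
by rewrite star_gdelta /= !linear_extension_gdelta.
Qed.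

Definition supported_in (E : seq G) x := forall g, g \notin E -> mcoeff g x = 0.

Lemma supported_size (E : seq G) x : supported_in E x -> (size (msupp x) <= size E)%N.
Proof.
move=> xE; apply: uniq_leq_size => [|g]; first exact: fset_uniq.
by rewrite -mcoeff_neq0; apply: contra_neqT => /xE.
Qed.

Lemma supported_star (E : seq G) x : (forall g, g \in E -> (g^-1)%g \in E) ->
  supported_in E x -> supported_in E (star x).
Proof.
move=> EV xE k kE; rewrite [star x]/(gstar x) raddf_sum big1_seq// => g /andP[_ gx].
rewrite /= mcoeffZ gdelta_coeff; case: eqP => [gk|_]; last by rewrite mulr0.
suff -> : mcoeff g x = 0 by rewrite conjC0 mul0r.
by apply: xE; apply: contra kE => gE; rewrite -gk EV.
Qed.

Lemma supported_mul (E : seq G) x y : {in E &, forall g h, (g * h)%g \in E} ->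
  supported_in E x -> supported_in E y -> supported_in E (x ** y).
Proof.
move=> EM xE yE k kE; rewrite [x ** y]/(gmul x y) raddf_sum big1_seq// => g _.
rewrite /= mcoeffZ raddf_sum mulr_sumr big1_seq// => h _.
rewrite /= mcoeffZ gdelta_coeff; case: eqP => [ghk|_]; last by rewrite !mulr0.
have [gE|/xE ->] := boolP (g \in E); last by rewrite mul0r.
have [hE|/yE ->] := boolP (h \in E); last by rewrite mul0r mulr0.
by rewrite -ghk EM in kE.
Qed.

(** Finitely many commuting involutions generate a finite group. Adding one
    involution k to the generators turns E into the union of E and kE. *)
Lemma boolean_subgroup (s : seq G) : (forall g h, (g * h = h * g)%g) ->
  (forall g, (g * g = 1)%g) ->
  exists E : seq G, {subset s <= E} /\ {in E &, forall g h, (g * h)%g \in E}.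
Proof.
move=> GC G2; suff [E [sE _ EM]] : exists E : seq G, [/\ {subset s <= E}, (1%g : G) \in E &
    {in E &, forall g h, (g * h)%g \in E}] by exists E.
elim: s => [|k s [E [sE E1 EM]]].
  exists [:: 1%g]; split=> // [|g h]; rewrite !inE// => /eqP-> /eqP->.
  by rewrite mulg1.
have memE g : g \in E ++ map (fun h => k * h)%g E <->
    g \in E \/ exists2 h, h \in E & g = (k * h)%g.
  rewrite mem_cat; split=> [/orP[|/mapP]|[->//|gk]]; [by left|by right|].
  by apply/orP; right; apply/mapP.
exists (E ++ map (fun h => k * h)%g E); split.
- move=> g; rewrite inE => /predU1P[->|/sE gE]; apply/memE; last by left.
  by right; exists 1%g; rewrite ?mulg1.
- by apply/memE; left.
move=> g h /memE[gE|[g' gE ->]] /memE[hE|[h' hE ->]]; apply/memE.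
- by left; exact: EM.
- by right; exists (g * h')%g; [exact: EM|rewrite mulgA (GC g) mulgA].
- by right; exists (g' * h)%g; [exact: EM|rewrite mulgA].
- by left; rewrite (GC k g') -mulgA (mulgA k k) G2 mul1g; exact: EM.
Qed.

Lemma star_hom_gdelta_le1 (B : cstarAlgType R) (pi : {linear CG -> B}) g :
  star_hom pi -> rnorm (pi (gdelta R g)) <= 1.
Proof.
move=> [piM piS].
have g1 : rnorm (pi (gdelta R g)) ^+ 2 = rnorm (pi (gdelta R 1%g)).
  by rewrite -rnorm_starM -piS -piM star_gdelta amul_gdelta mulVg.
have e1 : rnorm (pi (gdelta R 1%g)) ^+ 2 = rnorm (pi (gdelta R 1%g)).
  by rewrite -rnorm_starM -piS -piM star_gdelta amul_gdelta mulVg.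
have e0 := rnorm_ge0 (pi (gdelta R 1%g)).
rewrite -(@ler_sqr _ _ 1) ?nnegrE ?rnorm_ge0// expr1n g1.
by move: e1 e0; set t := rnorm _ => *; nra.
Qed.

Lemma star_hom_l1_bound (B : cstarAlgType R) (pi : {linear CG -> B}) x :
  star_hom pi -> rnorm (pi x) <= \sum_(g <- msupp x) complex.Re `|mcoeff g x|.
Proof.
move=> piH; rewrite {1}[x]group_algebraE linear_sum.
elim: (msupp x : seq G) => [|g s IHs]; first by rewrite !big_nil rnorm0.
rewrite !big_cons; apply: le_trans (rnormD _ _) _; rewrite lerD//.
by rewrite linearZ rnormZ ler_piMr ?star_hom_gdelta_le1// cabs_ge0.
Qed.

End GroupAlgebraTheory.

Section SpectralRadius.
Variable R : realType.

(** If b < a then (b / a) ^ m would tend to 0, while staying above 1 / c along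
    the powers of 2. *)
Lemma le_of_powers (a b c : R) : 0 <= a -> 0 <= b ->
  (forall n, a ^+ (2 ^ n) <= c * b ^+ (2 ^ n)) -> a <= b.
Proof.
move=> a0 b0 abc; rewrite leNgt; apply/negP => ba.
have a_gt0 : 0 < a by exact: le_lt_trans ba.
have q1 : `|b / a| < 1.
  by rewrite ger0_norm ?divr_ge0// ltr_pdivrMr// mul1r.
have c0 : 0 < `|c| + 1 by rewrite ltr_wpDl.
have c0' : 0 < (`|c| + 1)^-1 by rewrite invr_gt0.
have /cvgrPdist_lt/(_ _ c0')[N _ NP] := cvg_expr q1.
have := NP (2 ^ N)%N (ltnW (ltn_expl N (isT : 1 < 2)%N)).
rewrite /= sub0r normrN ger0_norm ?exprn_ge0 ?divr_ge0// expr_div_n.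
rewrite ltr_pdivrMr ?exprn_gt0// mulrC ltr_pdivlMr// ltNge => /negP; apply.
apply: le_trans (abc N) _; rewrite mulrC ler_wpM2l ?exprn_ge0//.
by rewrite (le_trans (ler_norm _))// lerDl.
Qed.

Variables (V : starAlgType R).

(** (x^* x)^(2^n), by repeated squaring: all these elements are self-adjoint,
    so that the C*-identity computes their norms in every *-representation. *)
Definition selfadjoint_power (x : V) (n : nat) : V := iter n (fun y => y ** y) (star x ** x).

Lemma selfadjoint_power_star x n :
  star (selfadjoint_power x n) = selfadjoint_power x n.
Proof. by elim: n => [|n IHn] /=; rewrite starM ?starK// IHn. Qed.

Lemma rnorm_selfadjoint_power (B : cstarAlgType R) (pi : {linear V -> B}) x n :
  star_hom pi -> rnorm (pi (selfadjoint_power x n)) = rnorm (pi x) ^+ (2 ^ n.+1).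
Proof.
move=> [piM piS]; elim: n => [|n IHn].
  by rewrite /= piM piS rnorm_starM.
rewrite /= piM -{1}selfadjoint_power_star piS rnorm_starM IHn.
by rewrite -exprM -expnSr.
Qed.

End SpectralRadius.

(** * The Cantor cube and its characters *)

Section Cube.
Variable K : choiceType.
Local Notation C2 := (cube K).
Implicit Types (x y : C2) (k : K).

Lemma cube_near x (s : seq K) : \forall y \near x, forall k, k \in s -> y k = x k.
Proof.
elim: s => [|k s IHs]; first by near=> y.
have xk : \forall y \near x, y k = x k.
  have := @proj_continuous K (fun=> bool) k x [set x k].
  by apply; exact: discrete_set1.
near=> y => l; rewrite inE => /predU1P[->|]; first by near: y.
by move: l; near: y.
Unshelve. all: by end_near. Qed.

Lemma cube_nbhs x (U : set C2) : nbhs x U ->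
  exists s : seq K, forall y, (forall k, k \in s -> y k = x k) -> U y.
Proof.
pose F := filter_from [set: seq K] (fun s => [set y : C2 | forall k, k \in s -> y k = x k]).
have FF : Filter F.
  apply: filter_from_filter; first by exists [::].
  move=> s t _ _; exists (s ++ t) => // y yst; split=> k ks; apply: yst.
    by rewrite mem_cat ks.
  by rewrite mem_cat ks orbT.
suff Fx : F --> x by move=> /Fx[s _ sU]; exists s.
apply/cvg_sup => k; apply/cvg_image.
  by apply/seteqP; split=> // b _; exists (fun=> b).
move=> W xW; exists (@^~ k @^-1` W) => //.
  exists [:: k] => // y /(_ k (mem_head _ _)) yk; rewrite /= yk.
  exact: nbhs_singleton.
by rewrite image_preimage//; apply/seteqP; split=> // b _; exists (fun=> b).
Qed.

Lemma cube_hausdorff : hausdorff_space C2.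
Proof. by apply: hausdorff_product => k; exact: discrete_hausdorff. Qed.

Lemma cube_no_Gdelta x : ~ countable [set: K] -> ~ Gdelta [set x].
Proof.
move=> Kunc [U oU xU]; apply: Kunc.
have Ux n : nbhs x (U n).
  apply: open_nbhs_nbhs; split=> //.
  have : (\bigcap_i U i) x by rewrite -xU.
  exact.
have /choice[s sU] := fun n => cube_nbhs (Ux n).
rewrite (_ : [set: K] = \bigcup_n [set` s n]); last first.
  apply/seteqP; split=> // k _; apply: contrapT => ks.
  (* Changing a coordinate that none of the cylinders sees leaves y in every
     U n. *)
  pose y : C2 := fun l => if l == k then ~~ x k else x l.
  have : [set x] y.
    rewrite xU => n _; apply: sU => l ls; rewrite /y; case: eqP => // lk.
    by case: ks; exists n => //=; rewrite -lk.
  move=> /(congr1 (fun f : C2 => f k)); rewrite /y eqxx.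
  by case: (x k).
by apply: bigcup_countable => // n _; exact: finite_set_countable.
Qed.

End Cube.

Section Characters.
Variables (R : realType) (K : choiceType).
Local Notation G := (direct_sum_Z2 K).
Local Notation C2 := (cube K).
Local Notation CX := (contfun R (cube_compact (K:=K))).
Implicit Types (g h : G) (x : C2).

Definition gsupp g : {fset K} := msupp (g : malg K 'Z_2).

Lemma gsuppE g k : (k \in gsupp g) = (mcoeff k (g : malg K 'Z_2) != 0).
Proof. by rewrite -mcoeff_neq0. Qed.

Lemma Z2_neq0_add (a b : 'Z_2) : (a + b != 0) = (a != 0) (+) (b != 0).
Proof. by case: a => [[|[|]]] //; case: b => [[|[|]]]. Qed.

(** Supports form the group of finite subsets of K with symmetric difference, as
    1 is the only nonzero element of Z/2. *)
Lemma gsuppM g h k : (k \in gsupp (g * h)%g) = (k \in gsupp g) (+) (k \in gsupp h).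
Proof. by rewrite !gsuppE -Z2_neq0_add -mcoeffD. Qed.

Lemma gsupp_inj : injective gsupp.
Proof.
move=> g h gh; apply/malgP => k.
have : (k \in gsupp g) = (k \in gsupp h) by rewrite gh.
rewrite !gsuppE; move: (mcoeff k g) (mcoeff k h).
by case=> [[|[|]]] // ?; case=> [[|[|]]] // ?  _; apply: val_inj.
Qed.

Lemma gsupp1 : gsupp 1%g = fset0.
Proof. exact: msupp0. Qed.

Lemma direct_sum_Z2C g h : (g * h = h * g)%g.
Proof. exact: (@addrC (malg K 'Z_2)). Qed.

Lemma direct_sum_Z2_sq g : (g * g = 1)%g.
Proof. by apply: gsupp_inj; apply/fsetP => k; rewrite gsuppM addbb gsupp1 inE. Qed.

Lemma direct_sum_Z2V g : (g^-1 = g)%g.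
Proof. by rewrite -[LHS]mulg1 -(direct_sum_Z2_sq g) mulgA mulVg mul1g. Qed.

Lemma Z2_pairingEw g x (D : {fset K}) : (gsupp g `<=` D)%fset ->
  Z2_pairing R g x = \prod_(k <- D) (-1) ^+ (x k && (k \in gsupp g)).
Proof.
move=> gD; rewrite -(big_fset_incl _ gD) => [|k _ /negPf->]; last first.
  by rewrite andbF.
by apply: eq_big_seq => k kg; rewrite [k \in _]kg andbT.
Qed.

Lemma Z2_pairingM g h x :
  Z2_pairing R (g * h)%g x = Z2_pairing R g x * Z2_pairing R h x.
Proof.
pose D := (gsupp g `|` gsupp h)%fset.
rewrite (@Z2_pairingEw g x D) ?fsubsetUl// (@Z2_pairingEw h x D) ?fsubsetUr//.
rewrite (@Z2_pairingEw _ x D).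
  rewrite -big_split/=; apply: eq_bigr => k _.
  by rewrite gsuppM; case: (x k); rewrite ?signr_addb//= mulr1.
apply/fsubsetP => k; rewrite gsuppM inE.
by case: (k \in gsupp g) => //= ->.
Qed.

Lemma Z2_pairing_real g x : (Z2_pairing R g x)^* = Z2_pairing R g x.
Proof.
rewrite /Z2_pairing rmorph_prod; apply: eq_bigr => k _.
by rewrite rmorph_sign.
Qed.

Lemma cabs_Z2_pairing g x : complex.Re `|Z2_pairing R g x| = 1.
Proof.
rewrite /Z2_pairing normr_prod big1//= => k _.
by rewrite normrX normrN1 expr1n.
Qed.

Definition flip (k : K) x : C2 := fun l => if l == k then ~~ x l else x l.

Lemma Z2_pairing_flip g x k :
  Z2_pairing R g (flip k x) = (-1) ^+ (k \in gsupp g) * Z2_pairing R g x.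
Proof.
have [kg|kg] := boolP (k \in gsupp g); last first.
  rewrite mul1r; apply: eq_big_seq => l lg; rewrite /flip; case: eqP => // lk.
  by rewrite -lk lg in kg.
rewrite /Z2_pairing !(big_fsetD1 k kg)/= {1}/flip eqxx mulrA; congr (_ * _).
  by case: (x k); rewrite ?expr1 ?expr0 ?mulr1 ?mulrNN ?mulr1.
apply: eq_big_seq => l; rewrite !inE /flip => /andP[/negPf->].
by [].
Qed.

Lemma Z2_pairing_continuous g : Z2_pairing R g \in @continuous_pred R C2.
Proof.
apply/continuous_predP/continuousCP => x e e0.
apply: filterS (cube_near x (gsupp g)) => y yx.
rewrite (_ : Z2_pairing R g y = Z2_pairing R g x) ?subrr ?normr0//.
by apply: eq_big_seq => k /yx ->.
Qed.

Definition character g : CX := ContFun (cube_compact (K:=K)) (Z2_pairing_continuous g).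

Definition gelfand : {linear group_algebra R G -> CX} := linear_extension character.

Lemma gelfand_hom : star_hom gelfand.
Proof.
apply: linear_extension_star_hom => [g h|g]; apply: contfunP => x.
  exact: Z2_pairingM.
by rewrite direct_sum_Z2V; apply/esym/Z2_pairing_real.
Qed.

Lemma gelfandE (y : group_algebra R G) x :
  gelfand y x = \sum_(g <- msupp y) mcoeff g y * Z2_pairing R g x.
Proof.
rewrite /gelfand /= /linear_extension.
by elim: (msupp y : seq G) => [|g s IHs]; rewrite ?big_nil// !big_cons contfunD IHs.
Qed.

(** Fourier coefficients are bounded by the supremum norm. In place of an
    integral over 2^K against the character of g, average over the flips of one
    coordinate k at a time, with the sign of g at k: this kills the terms of
    those h whose support differs from that of g at k and does not increase
    the bound. After the finitely many coordinates that occur, only g is left. *)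
Lemma gelfand_coeff (y : group_algebra R G) g :
  complex.Re `|mcoeff g y| <= rnorm (gelfand y).
Proof.
have [gy|/mcoeff_outdom->] := boolP (g \in msupp y); last first.
  by rewrite normr0; exact: rnorm_ge0.
pose agree (s : seq K) h := all (fun k => (k \in gsupp h) == (k \in gsupp g)) s.
have avg s x : complex.Re `|\sum_(h <- msupp y | agree s h)
    mcoeff h y * Z2_pairing R h x| <= rnorm (gelfand y).
  elim: s x => [|k s IHs] x; first by rewrite -gelfandE; exact: (cabs_le_supnorm (gelfand y)).
  pose S z := \sum_(h <- msupp y | agree s h) mcoeff h y * Z2_pairing R h z.
  have -> : \sum_(h <- msupp y | agree (k :: s) h) mcoeff h y * Z2_pairing R h x =
      2^-1 * (S x + (-1) ^+ (k \in gsupp g) * S (flip k x)).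
    rewrite /S !mulr_sumr -big_split mulr_sumr.
    rewrite big_mkcond [RHS]big_mkcond; apply: eq_bigr => h _ /=.
    case: (agree s h); rewrite ?andbT ?andbF// Z2_pairing_flip.
    by case: (k \in gsupp h); case: (k \in gsupp g) => /=; field.
  have half : complex.Re `|2^-1 : R[i]| = 2^-1.
    have -> : (2^-1 : R[i]) = (2^-1 : R)%:C by rewrite fmorphV rmorph_nat.
    by rewrite cabs_real ?invr_ge0.
  rewrite cabsM half ler_pdivrMl// [2 * _]mulr_natl mulr2n.
  apply: le_trans (cabsD _ _) _; rewrite lerD ?IHs//.
  by rewrite cabsM normrX normrN1 expr1n mul1r; exact: IHs.
pose D := flatten [seq (gsupp h : seq K) | h <- msupp y].
have := avg D (fun=> false); rewrite -big_filter.
have -> : [seq h <- msupp y | agree D h] = [:: g].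
  have u : uniq [seq h <- msupp y | agree D h] by rewrite filter_uniq// fset_uniq.
  apply: perm_small_eq => //; apply: uniq_perm => // h.
  rewrite mem_filter inE; apply/andP/eqP => [[/allP hD hy]|->]; last first.
    by split=> //; apply/allP.
  apply: gsupp_inj; apply/fsetP => k; apply/idP/idP => kh.
    rewrite -(eqP (hD k _))//; apply/flattenP; exists (gsupp h : seq K) => //.
    exact: map_f.
  rewrite (eqP (hD k _))//; apply/flattenP; exists (gsupp g : seq K) => //.
  exact: map_f.
by rewrite big_seq1 cabsM cabs_Z2_pairing mulr1.
Qed.

(** For any *-representation pi, the powers z = (y^* y)^(2^n) remain supported in a
    finite group E, so |pi z| <= sum of the |z_g| <= |E| |gelfand z|. By the
    C*-identity on both sides this reads |pi y|^(2^(n+1)) <= |E|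
    |gelfand y|^(2^(n+1)), and the factor |E| disappears as n grows. *)
Lemma full_norm_gelfand (y : group_algebra R G) : full_norm y = rnorm (gelfand y).
Proof.
apply/eqP; rewrite eq_le full_norm_ge ?andbT; last exact: gelfand_hom.
apply: full_norm_le => [|B pi piH]; first exact: rnorm_ge0.
have [E [yE EM]] := boolean_subgroup (msupp y) direct_sum_Z2C direct_sum_Z2_sq.
have sy : supported_in E y.
  by move=> g gE; apply: mcoeff_outdom; apply: contra gE; exact: yE.
have supp n : supported_in E (selfadjoint_power y n).
  elim: n => [|n IHn]; apply: supported_mul => //.
  by apply: supported_star => // g; rewrite direct_sum_Z2V.
have l1 z : supported_in E z -> rnorm (pi z) <= (size E)%:R * rnorm (gelfand z).
  move=> zE; apply: le_trans (star_hom_l1_bound _ piH) _.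
  apply: (@le_trans _ _ (\sum_(g <- msupp z) rnorm (gelfand z))).
    by apply: ler_sum => g _; exact: gelfand_coeff.
  rewrite big_const_seq count_predT iter_addr_0 -[leLHS]mulr_natl.
  by rewrite ler_wpM2r ?rnorm_ge0// ler_nat supported_size.
apply: (@le_of_powers _ _ _ (size E)%:R); rewrite ?rnorm_ge0// => -[|n].
  by rewrite !expr1; exact: l1.
by rewrite -!rnorm_selfadjoint_power//; [exact: l1|exact: gelfand_hom].
Qed.

End Characters.

Section Density.
Variables (R : realType) (K : choiceType).
Local Notation G := (direct_sum_Z2 K).
Local Notation C2 := (cube K).
Local Notation CX := (contfun R (cube_compact (K:=K))).

Definition agree_on (s : seq K) (x y : C2) := forall k, k \in s -> x k = y k.

(** Uniform continuity on 2^K: by compactness, one finite set of coordinates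
    works for all points. *)
Lemma contfun_cube_finite_support (f : CX) (e : R) : 0 < e ->
  exists s, forall x y, agree_on s x y -> complex.Re `|f x - f y| < e.
Proof.
move=> e0; have e20 := divr_gt0 e0 (ltr0n R 2).
pose F := filter_from [set: seq K] (fun s => [set t : seq K | {subset s <= t}]).
have FF : ProperFilter F.
  apply: filter_from_proper; last by move=> s _; exists s.
  apply: filter_from_filter; first by exists [::].
  move=> s t _ _; exists (s ++ t) => // u su.
  by split=> k ks; apply: su; rewrite mem_cat ks ?orbT.
have := cube_compact (K:=K); move=> /compact_near_coveringP/(_ _ F
  (fun s x => forall y, agree_on s x y -> complex.Re `|f x - f y| < e) _).
case=> [x _|s _ sP].
  have [s sx] := cube_nbhs ((continuousCP f).1 (@contfun_continuous _ _ _ f) x _ e20).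
  exists ([set y | agree_on s y x], [set t : seq K | {subset s <= t}]).
    by split; [exact: cube_near|exists s].
  move=> [z t] [/= zx st] y zy.
  rewrite -(subrKA (f x)); apply: le_lt_trans (cabsD _ _) _.
  rewrite (splitr e) ltrD//; first by rewrite distrC; exact: sx.
  by apply: sx => k ks; rewrite -zx// zy//; exact: st.
by exists s => x y; exact: sP.
Qed.

Definition coordinate_generator (k : K) : G := mkmalgU k (1 : 'Z_2).

Lemma Z2_pairing_generator k (x : C2) :
  Z2_pairing R (coordinate_generator k) x = (-1) ^+ (x k).
Proof.
rewrite /Z2_pairing /coordinate_generator msuppU /=.
by rewrite big_seq_fset1.
Qed.

Lemma Z2_pairing1 (x : C2) : Z2_pairing R (1%g : G) x = 1.
Proof. by rewrite /Z2_pairing [msupp _]gsupp1 big_seq_fset0. Qed.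

Lemma gelfand_gdelta (g : G) x : gelfand R K (gdelta R g) x = Z2_pairing R g x.
Proof. by rewrite /gelfand /= linear_extension_gdelta. Qed.

(** By induction on the number of coordinates: if phi0 and phi1 are obtained
    from phi by freezing coordinate k, and chi is the character x |-> (-1)^(x k),
    then phi = (phi0 + phi1 + chi (phi0 - phi1)) / 2. *)
Lemma gelfand_finite_support (s : seq K) (phi : C2 -> R[i]) :
  (forall x y, agree_on s x y -> phi x = phi y) ->
  exists y : group_algebra R G, forall x, gelfand R K y x = phi x.
Proof.
elim: s phi => [|k s IHs] phi phiP.
  exists (phi (fun=> false) *: gdelta R (1%g : G)) => x.
  by rewrite linearZ contfunZ gelfand_gdelta Z2_pairing1 mulr1; exact: phiP.
pose set_k (b : bool) (x : C2) : C2 := fun l => if l == k then b else x l.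
have /IHs[y0 y0P] x y : agree_on s x y -> phi (set_k false x) = phi (set_k false y).
  move=> xy; apply: phiP => l; rewrite inE /set_k; case: eqP => //= _.
  exact: xy.
have /IHs[y1 y1P] x y : agree_on s x y -> phi (set_k true x) = phi (set_k true y).
  move=> xy; apply: phiP => l; rewrite inE /set_k; case: eqP => //= _.
  exact: xy.
have set_kE x : set_k (x k) x = x.
  by apply/funext => l; rewrite /set_k; case: eqP => // ->.
exists (2^-1 *: (y0 + y1 + gdelta R (coordinate_generator k) ** (y0 - y1))) => x.
have [gM _] := gelfand_hom R K.
have mulE (a b : CX) : (a ** b) x = a x * b x by [].
rewrite linearZ contfunZ !linearD contfunD contfunD gM.
rewrite mulE gelfand_gdelta Z2_pairing_generator.
rewrite linearB contfunB y0P y1P -[in RHS](set_kE x).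
by case: (x k) => /=; field.
Qed.

Lemma gelfand_dense (f : CX) (e : R) : 0 < e ->
  exists y, rnorm (gelfand R K y - f) < e.
Proof.
move=> e0; have e20 := divr_gt0 e0 (ltr0n R 2).
have [s sP] := contfun_cube_finite_support f e20.
(* f \o cut depends only on the coordinates in s, and is close to f. *)
pose cut (x : C2) : C2 := fun l => (l \in s) && x l.
have [x y xy|y yP] := @gelfand_finite_support s (fun x => f (cut x)).
  congr (f _); apply/funext => l; rewrite /cut.
  by have [ls|//] := boolP (l \in s); rewrite xy.
exists y; apply: (@le_lt_trans _ _ (e / 2)); last first.
  by rewrite ltr_pdivrMr// ltr_pMr// ltr1n.
apply: supnorm_le => [|x]; first exact: ltW.
rewrite contfunB yP ltW//; apply: sP => k ks.
by rewrite /cut ks.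
Qed.

End Density.

(** * Failure for C(X) and for the group C*-algebra *)

Theorem theorem2 (R : realType) :
  (forall (X : topologicalType) (cX : compact [set: X]),
     hausdorff_space X ->
     totally_disconnected [set: X] ->
     ~ extremally_disconnected X ->
     (forall x : X, ~ Gdelta [set x]) ->
     ~ lifting_property (contfun R cX)) /\
  (forall K : choiceType, ~ countable [set: K] ->
     [/\ exists Phi : {linear group_cstar R (direct_sum_Z2 K) ->
                              contfun R (cube_compact (K:=K))},
           star_isomorphism Phi /\
           (forall g x, Phi (group_unitary R g) x = Z2_pairing R g x),
         ~ lifting_property (group_cstar R (direct_sum_Z2 K)) &
         ~ lifting_property (contfun R (cube_compact (K:=K)))]).
Proof.
split=> [X cX hX _ nED noG|K Kunc].
  apply: compact_without_Gdelta_no_lifting => //.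
  (* The empty space is extremally disconnected. *)
  apply: contrapT => X0; apply: nED => U _.
  rewrite (_ : closure U = set0); first exact: open0.
  by apply/seteqP; split=> // x _; apply: X0; exists x.
have gelfandN x : rnorm (gelfand R K x) = full_seminorm R (direct_sum_Z2 K) x.
  by rewrite -full_norm_gelfand.
pose Phi : {linear group_cstar R (direct_sum_Z2 K) -> contfun R (cube_compact (K:=K))} :=
  completion_extension gelfandN.
have PhiI : star_isomorphism Phi.
  apply: completion_extension_isomorphism; first exact: gelfand_hom.
  exact: gelfand_dense.
have noLP : ~ lifting_property (contfun R (cube_compact (K:=K))).
  apply: compact_without_Gdelta_no_lifting; first exact: cube_hausdorff.
    by exists (fun=> false).
  by move=> x; exact: cube_no_Gdelta.
split=> //.
  exists Phi; split=> // g x.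
  by rewrite -gelfand_gdelta; congr (cfun_val _ x); exact: completion_extension_in.
move=> LP; apply: noLP; apply: lifting_property_isomorphism PhiI _ LP => a.
by rewrite !rnormE completion_extension_isometry.
Qed.
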